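(* Let $n,m\ge1$, let $p_{n,m}$ be stable of degree $n$ in $z$ and $m$ in $w$, and let $L$ and $a_0,\dots,a_{m-1}$ be as defined in the context. In $L^2\!\left(\frac{d\sigma}{|p_{n,m}|^2}\right)$, for each $0\le k\le m-1$ the polynomial $a_k$ is orthogonal to every monomial in $$\mathcal{O}_k=\{z^iw^j: i>n,\ j<0\}\cup\{z^iw^j:0\le j<m,\ j\ne k\}\cup\{z^iw^j: i<n,\ j\ge m\}\cup\{z^iw^k: i\ne n\}$$ (all $i,j\in\mathbb{Z}$), and for every $\eta\in\mathbb{C}$ the polynomial $L(\cdot,\cdot;\eta)$ is orthogonal to every monomial in $$\mathcal{O}=\{z^iw^j: i>n,\ j<0\}\cup\{z^iw^j: i\ne n,\ 0\le j<m\}\cup\{z^iw^j: i<n,\ j\ge m\}.$$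
   Context: $\sigma$ is normalized Lebesgue measure on $\mathbb{T}^2$; a polynomial $p\in\mathbb{C}[z,w]$ is stable if it has no zeros in $\{|z|\le1,|w|\le1\}$. Inner products are $\langle f,g\rangle=\int_{\mathbb{T}^2}f\bar g\,\frac{d\sigma}{|p_{n,m}|^2}$. Set $\tilde p_{n,m}(z,w)=z^nw^m\overline{p_{n,m}(1/\bar z,1/\bar w)}$ and $$L(z,w;\eta)=z^n\,\frac{p_{n,m}(z,w)\overline{p_{n,m}(1/\bar z,\eta)}-\tilde p_{n,m}(z,w)\overline{\tilde p_{n,m}(1/\bar z,\eta)}}{1-w\bar\eta},$$ which is a polynomial in $(z,w,\bar\eta)$ of degree at most $m-1$ in $\bar\eta$; the polynomials $a_j(z,w)$ are defined by $L(z,w;\eta)=\sum_{j=0}^{m-1}a_j(z,w)\bar\eta^j$. *)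

(* Defs.v *)
From Stdlib Require Import Reals ZArith.
Open Scope R_scope.

Definition Cx : Type := (R * R)%type.
Definition Cre (z : Cx) : R := fst z.
Definition Cim (z : Cx) : R := snd z.
Definition C0 : Cx := (0, 0).
Definition C1 : Cx := (1, 0).
Definition Cadd (a b : Cx) : Cx := (fst a + fst b, snd a + snd b).
Definition Copp (a : Cx) : Cx := (- fst a, - snd a).
Definition Csub (a b : Cx) : Cx := Cadd a (Copp b).
Definition Cmul (a b : Cx) : Cx :=
  (fst a * fst b - snd a * snd b, fst a * snd b + snd a * fst b).
Definition Cconj (a : Cx) : Cx := (fst a, - snd a).
Definition Cnorm2 (a : Cx) : R := fst a * fst a + snd a * snd a.
Definition Cinv (a : Cx) : Cx := (fst a / Cnorm2 a, - snd a / Cnorm2 a).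
Definition Cdiv (a b : Cx) : Cx := Cmul a (Cinv b).
Definition Cscale (r : R) (a : Cx) : Cx := (r * fst a, r * snd a).
Fixpoint Cpow (a : Cx) (k : nat) : Cx :=
  match k with O => C1 | S k' => Cmul a (Cpow a k') end.
Fixpoint Csum (N : nat) (f : nat -> Cx) : Cx :=
  match N with O => C0 | S N' => Cadd (Csum N' f) (f N') end.

Definition Cexpi (t : R) : Cx := (cos t, sin t).

Definition peval (n m : nat) (c : nat -> nat -> Cx) (z w : Cx) : Cx :=
  Csum (S n) (fun i => Csum (S m) (fun j =>
     Cmul (c i j) (Cmul (Cpow z i) (Cpow w j)))).

Definition has_bidegree (n m : nat) (c : nat -> nat -> Cx) : Prop :=
  (exists j, (j <= m)%nat /\ c n j <> C0) /\
  (exists i, (i <= n)%nat /\ c i m <> C0).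

Definition stable (n m : nat) (c : nat -> nat -> Cx) : Prop :=
  forall z w : Cx, Cnorm2 z <= 1 -> Cnorm2 w <= 1 -> peval n m c z w <> C0.

(** reflected polynomial  p~(z,w) = z^n w^m conj(p(1/conj z, 1/conj w))
    (formula valid for z, w <> 0) *)
Definition ptilde (n m : nat) (c : nat -> nat -> Cx) (z w : Cx) : Cx :=
  Cmul (Cmul (Cpow z n) (Cpow w m))
       (Cconj (peval n m c (Cinv (Cconj z)) (Cinv (Cconj w)))).

(** L(z,w;eta) by its defining formula (valid for z<>0, eta<>0, w conj(eta) <> 1) *)
Definition Lformula (n m : nat) (c : nat -> nat -> Cx) (z w eta : Cx) : Cx :=
  Cmul (Cpow z n)
    (Cdiv
      (Csub (Cmul (peval n m c z w) (Cconj (peval n m c (Cinv (Cconj z)) eta)))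
            (Cmul (ptilde n m c z w) (Cconj (ptilde n m c (Cinv (Cconj z)) eta))))
      (Csub C1 (Cmul w (Cconj eta)))).

Definition L_coeffs (n m : nat) (c : nat -> nat -> Cx) (a : nat -> Cx -> Cx -> Cx) : Prop :=
  forall z w eta : Cx, z <> C0 -> w <> C0 -> eta <> C0 ->
    Cmul w (Cconj eta) <> C1 ->
    Lformula n m c z w eta = Csum m (fun j => Cmul (a j z w) (Cpow (Cconj eta) j)).

Definition Lpoly (m : nat) (a : nat -> Cx -> Cx -> Cx) (eta : Cx) (z w : Cx) : Cx :=
  Csum m (fun j => Cmul (a j z w) (Cpow (Cconj eta) j)).

Definition Int2 (F : R -> R -> R) (v : R) : Prop :=
  exists (pr_in : forall ph : R, Riemann_integrable (fun th => F th ph) 0 (2 * PI)),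
  exists (pr_out : Riemann_integrable (fun ph => RiemannInt (pr_in ph)) 0 (2 * PI)),
    RiemannInt pr_out = v.

Definition ip_integrand (n m : nat) (c : nat -> nat -> Cx)
  (f : Cx -> Cx -> Cx) (g : R -> R -> Cx) (th ph : R) : Cx :=
  Cscale (/ (4 * PI * PI) * / Cnorm2 (peval n m c (Cexpi th) (Cexpi ph)))
         (Cmul (f (Cexpi th) (Cexpi ph)) (Cconj (g th ph))).

Definition orthogonal (n m : nat) (c : nat -> nat -> Cx)
  (f : Cx -> Cx -> Cx) (g : R -> R -> Cx) : Prop :=
  Int2 (fun th ph => Cre (ip_integrand n m c f g th ph)) 0 /\
  Int2 (fun th ph => Cim (ip_integrand n m c f g th ph)) 0.

(** the monomial z^i w^j (i, j integers) on the torus, z = e^{i th}, w = e^{i ph} *)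
Definition mono (i j : Z) (th ph : R) : Cx := Cexpi (IZR i * th + IZR j * ph).

Definition in_Ok (n m k : nat) (i j : Z) : Prop :=
  ((i > Z.of_nat n)%Z /\ (j < 0)%Z) \/
  ((0 <= j < Z.of_nat m)%Z /\ j <> Z.of_nat k) \/
  ((i < Z.of_nat n)%Z /\ (j >= Z.of_nat m)%Z) \/
  (j = Z.of_nat k /\ i <> Z.of_nat n).

Definition in_O (n m : nat) (i j : Z) : Prop :=
  ((i > Z.of_nat n)%Z /\ (j < 0)%Z) \/
  (i <> Z.of_nat n /\ (0 <= j < Z.of_nat m)%Z) \/
  ((i < Z.of_nat n)%Z /\ (j >= Z.of_nat m)%Z).

(* Main.v *)
(** On the torus, for real [0 < r < 1], [L(z,w;r) / |p|^2] is a difference of two terms: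
[z^n conj(p(z,r)) / (conj(p(z,w)) (1 - w r))], which is [z^n] times the conjugate of
[(p(z,r) / p(z,w)) (w / (w - r))], analytic in [z] and, up to a Cauchy kernel at [r], in [w];
and [z^n w^m r^m p(z,1/r) / (p(z,w) (1 - w r))], analytic in each variable. Integrated
against [conj(z^i w^j)], the first term vanishes for [i > n] by the mean value property in
[z], and for [j >= 0] it gives, by Cauchy's formula in [w], [r^j] if [i = n] and [0]
otherwise; the second vanishes for [i < n] by the mean value property in [z] and for [j < m]
by the one in [w]. Comparing coefficients of powers of [r] gives the moments of each [a_k]. *)

From Coquelicot Require Import Hierarchy Derive Continuity RInt RInt_analysis AutoDerive.
From Stdlib Require Import Reals ZArith Lra Lia FunctionalExtensionality.
Require Import Defs.
Open Scope R_scope.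

(** Taking [eta = r] real in [(0, 1)] avoids both exceptional sets of the identity that defines the
    [a_k]: [eta = 0], and [w * conj eta = 1], which cannot occur for [|w| = 1]. These values
    suffice, because they determine the coefficients of a polynomial in [r]. The [a_k] are arbitrary
    functions apart from that identity, so the continuity of their integrands has to be recovered
    along with their moments, by the same linear combinations. The iterated integral has [z]
    innermost; every argument in [w] therefore rests on an exchange of integrals, proved for jointly
    continuous integrands. Cauchy's formula is obtained by real calculus: the circle is contracted
    to the pole and the integral is differentiated in the contraction parameter. Holomorphy is thus
    only required along such contractions, in one variable at a time, with the other variable
    frozen. *)

Lemma Cx_eq (a b : Cx) : fst a = fst b -> snd a = snd b -> a = b.
Proof. destruct a, b; simpl; congruence. Qed.

Lemma Cnorm2_pos (a : Cx) : a <> C0 -> 0 < Cnorm2 a.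
Proof.
  destruct a as [x y]; unfold Cnorm2, C0; simpl; intros H.
  destruct (Req_dec x 0) as [-> |Hx]; [|nra].
  destruct (Req_dec y 0) as [-> |Hy]; [now elim H|nra].
Qed.

Lemma Cx_field_theory : field_theory C0 C1 Cadd Cmul Csub Copp Cdiv Cinv eq.
Proof.
  constructor.
  - constructor; intros; apply Cx_eq; simpl; ring.
  - intros H; injection H; lra.
  - reflexivity.
  - intros a Ha; pose proof (Cnorm2_pos a Ha) as H.
    unfold Cnorm2 in H.
    apply Cx_eq; unfold Cinv, Cnorm2; simpl; field; lra.
Qed.

Add Field Cx_field : Cx_field_theory.

Lemma Cmul_neq0 (a b : Cx) : a <> C0 -> b <> C0 -> Cmul a b <> C0.
Proof.
  intros Ha Hb H; apply Hb.
  replace b with (Cmul (Cinv a) (Cmul a b)) by (field; assumption).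
  rewrite H; ring.
Qed.

Lemma Cconj_sub (a b : Cx) : Cconj (Csub a b) = Csub (Cconj a) (Cconj b).
Proof. apply Cx_eq; simpl; ring. Qed.

Lemma Cconj_mul (a b : Cx) : Cconj (Cmul a b) = Cmul (Cconj a) (Cconj b).
Proof. apply Cx_eq; simpl; ring. Qed.

Lemma Cconj_inv (a : Cx) : Cconj (Cinv a) = Cinv (Cconj a).
Proof.
  unfold Cinv, Cconj, Cnorm2, Rdiv; apply Cx_eq; simpl;
    rewrite Rmult_opp_opp; ring.
Qed.

Lemma Cconj_div (a b : Cx) : Cconj (Cdiv a b) = Cdiv (Cconj a) (Cconj b).
Proof. unfold Cdiv; now rewrite Cconj_mul, Cconj_inv. Qed.

Lemma Cconj_invol (a : Cx) : Cconj (Cconj a) = a.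
Proof. apply Cx_eq; simpl; ring. Qed.

Lemma Cconj_neq0 (a : Cx) : a <> C0 -> Cconj a <> C0.
Proof.
  intros H E; apply H; rewrite <- (Cconj_invol a), E; apply Cx_eq; simpl; ring.
Qed.

Definition RtoC (r : R) : Cx := (r, 0).

Lemma Cscale_mul (r : R) (a : Cx) : Cscale r a = Cmul (RtoC r) a.
Proof. apply Cx_eq; simpl; ring. Qed.

Lemma RtoC_mul (r s : R) : RtoC (r * s) = Cmul (RtoC r) (RtoC s).
Proof. apply Cx_eq; simpl; ring. Qed.

Lemma RtoC_inv (r : R) : r <> 0 -> RtoC (/ r) = Cinv (RtoC r).
Proof. intros H; apply Cx_eq; unfold Cinv, Cnorm2; simpl; field; auto. Qed.

Lemma RtoC_neq0 (r : R) : r <> 0 -> RtoC r <> C0.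
Proof. intros H E; injection E; auto. Qed.

Lemma RtoC_Cnorm2 (a : Cx) : RtoC (Cnorm2 a) = Cmul a (Cconj a).
Proof. apply Cx_eq; unfold Cnorm2; simpl; ring. Qed.

Lemma Cconj_RtoC (r : R) : Cconj (RtoC r) = RtoC r.
Proof. apply Cx_eq; simpl; ring. Qed.

Lemma Cpow_RtoC (r : R) (k : nat) : Cpow (RtoC r) k = RtoC (r ^ k).
Proof.
  induction k as [|k IH]; [reflexivity|].
  simpl; rewrite IH; apply Cx_eq; simpl; ring.
Qed.

Lemma Cconj_pow (a : Cx) (k : nat) : Cconj (Cpow a k) = Cpow (Cconj a) k.
Proof.
  induction k as [|k IH]; [apply Cx_eq; simpl; ring|].
  simpl; now rewrite Cconj_mul, IH.
Qed.

Lemma Csum_ext (N : nat) (f g : nat -> Cx) :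
  (forall j, (j < N)%nat -> f j = g j) -> Csum N f = Csum N g.
Proof.
  induction N as [|N IH]; intros H; [reflexivity|].
  simpl; rewrite IH, H; auto.
Qed.

Lemma Csum_Cmul (N : nat) (x : Cx) (f : nat -> Cx) :
  Csum N (fun j => Cmul x (f j)) = Cmul x (Csum N f).
Proof. induction N as [|N IH]; simpl; [|rewrite IH]; ring. Qed.

Lemma Csum_sub (N : nat) (f g : nat -> Cx) :
  Csum N (fun j => Csub (f j) (g j)) = Csub (Csum N f) (Csum N g).
Proof. induction N as [|N IH]; simpl; [|rewrite IH]; ring. Qed.

(** The index [k] may lie outside the range, with value [C0]; this allows [k = Z.to_nat j] for an
    integer [j] not known to be below [m]. *)
Lemma Csum_single (N k : nat) (f : nat -> Cx) :
  (forall j, (j < N)%nat -> j <> k -> f j = C0) ->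
  Csum N f = if Nat.ltb k N then f k else C0.
Proof.
  induction N as [|N IH]; intros H; [reflexivity|].
  simpl; rewrite IH by (intros; apply H; lia).
  destruct (Nat.eq_dec N k) as [-> |E].
  - rewrite Nat.ltb_irrefl, (proj2 (Nat.ltb_lt k (S k))) by lia; ring.
  - rewrite (H N) by lia.
    destruct (Nat.ltb_spec k N), (Nat.ltb_spec k (S N)); try lia; ring.
Qed.

(** * Continuity of complex-valued functions of one and two real variables *)

Definition cont1 (f : R -> Cx) : Prop :=
  forall x, continuity_pt (fun t => fst (f t)) x /\ continuity_pt (fun t => snd (f t)) x.

(** Joint continuity is what differentiation under the integral and the exchange of integrals rely
    on; separate continuity would be too weak. *)
Definition cont2 (F : R -> R -> Cx) : Prop :=
  forall x y, continuity_2d_pt (fun s t => fst (F s t)) x y /\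
              continuity_2d_pt (fun s t => snd (F s t)) x y.

Lemma cont2_const (a : Cx) : cont2 (fun _ _ => a).
Proof. split; apply continuity_2d_pt_const. Qed.

Lemma cont2_add (F G : R -> R -> Cx) :
  cont2 F -> cont2 G -> cont2 (fun s t => Cadd (F s t) (G s t)).
Proof.
  intros HF HG x y; destruct (HF x y), (HG x y); split; simpl;
    now apply continuity_2d_pt_plus.
Qed.

Lemma cont2_opp (F : R -> R -> Cx) : cont2 F -> cont2 (fun s t => Copp (F s t)).
Proof.
  intros HF x y; destruct (HF x y); split; simpl; now apply continuity_2d_pt_opp.
Qed.

Lemma cont2_sub (F G : R -> R -> Cx) :
  cont2 F -> cont2 G -> cont2 (fun s t => Csub (F s t) (G s t)).
Proof. intros HF HG; apply cont2_add; [|apply cont2_opp]; assumption. Qed.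

Lemma cont2_conj (F : R -> R -> Cx) : cont2 F -> cont2 (fun s t => Cconj (F s t)).
Proof.
  intros HF x y; destruct (HF x y); split; simpl;
    [|apply continuity_2d_pt_opp]; assumption.
Qed.

Lemma cont2_mul (F G : R -> R -> Cx) :
  cont2 F -> cont2 G -> cont2 (fun s t => Cmul (F s t) (G s t)).
Proof.
  intros HF HG x y; destruct (HF x y), (HG x y); split; simpl.
  - apply continuity_2d_pt_minus; now apply continuity_2d_pt_mult.
  - apply continuity_2d_pt_plus; now apply continuity_2d_pt_mult.
Qed.

Lemma cont2_inv (F : R -> R -> Cx) :
  cont2 F -> (forall s t, F s t <> C0) -> cont2 (fun s t => Cinv (F s t)).
Proof.
  intros HF H0 x y; destruct (HF x y) as [H1 H2].
  assert (HN : continuity_2d_pt (fun s t => / Cnorm2 (F s t)) x y).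
  { apply continuity_2d_pt_inv.
    - apply continuity_2d_pt_plus; now apply continuity_2d_pt_mult.
    - apply Rgt_not_eq, Cnorm2_pos, H0. }
  split; simpl; apply continuity_2d_pt_mult; auto.
  now apply continuity_2d_pt_opp.
Qed.

Lemma cont2_div (F G : R -> R -> Cx) :
  cont2 F -> cont2 G -> (forall s t, G s t <> C0) ->
  cont2 (fun s t => Cdiv (F s t) (G s t)).
Proof. intros HF HG H0; apply cont2_mul; [|apply cont2_inv]; assumption. Qed.

Lemma cont2_pow (F : R -> R -> Cx) (k : nat) :
  cont2 F -> cont2 (fun s t => Cpow (F s t) k).
Proof.
  intros HF; induction k as [|k IH]; simpl; [apply cont2_const|now apply cont2_mul].
Qed.

Lemma cont2_sum (N : nat) (F : nat -> R -> R -> Cx) :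
  (forall k, cont2 (F k)) -> cont2 (fun s t => Csum N (fun k => F k s t)).
Proof.
  intros HF; induction N as [|N IH]; simpl; [apply cont2_const|now apply cont2_add].
Qed.

Lemma cont2_peval (n m : nat) (c : nat -> nat -> Cx) (F G : R -> R -> Cx) :
  cont2 F -> cont2 G -> cont2 (fun s t => peval n m c (F s t) (G s t)).
Proof.
  intros HF HG; unfold peval.
  apply (cont2_sum (S n) (fun i s t => Csum (S m) (fun j =>
    Cmul (c i j) (Cmul (Cpow (F s t) i) (Cpow (G s t) j))))); intros i.
  apply (cont2_sum (S m) (fun j s t =>
    Cmul (c i j) (Cmul (Cpow (F s t) i) (Cpow (G s t) j)))); intros j.
  apply cont2_mul; [apply cont2_const|].
  apply cont2_mul; now apply cont2_pow.
Qed.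

Lemma cont2_Cexpi1 (r : R) : cont2 (fun s t => Cexpi (r * s)).
Proof.
  split; simpl;
    (apply (continuity_1d_2d_pt_comp _ (fun s t => r * s));
     [first [apply continuity_cos | apply continuity_sin]|
      apply continuity_2d_pt_mult;
      [apply continuity_2d_pt_const | apply continuity_2d_pt_id1]]).
Qed.

Lemma cont2_swap (F : R -> R -> Cx) : cont2 F -> cont2 (fun s t => F t s).
Proof.
  intros HF x y; destruct (HF y x) as [H1 H2].
  split; intros eps; [destruct (H1 eps) as [d Hd] | destruct (H2 eps) as [d Hd]];
    exists d; intros u v Hu Hv; now apply Hd.
Qed.

Lemma cont2_Cexpi2 (r : R) : cont2 (fun s t => Cexpi (r * t)).
Proof. apply (cont2_swap (fun s t => Cexpi (r * s))), cont2_Cexpi1. Qed.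

Lemma continuity_2d_pt_section (f : R -> R -> R) (x y : R) :
  continuity_2d_pt f x y -> continuity_pt (fun s => f s y) x.
Proof.
  intros H; apply continuity_pt_filterlim, filterlim_locally; intros eps.
  destruct (H eps) as [d Hd]; exists d; intros s Hs; apply Hd; [exact Hs|].
  rewrite Rminus_diag, Rabs_R0; apply cond_pos.
Qed.

Lemma cont2_cont1 (F : R -> R -> Cx) (y : R) : cont2 F -> cont1 (fun s => F s y).
Proof.
  intros HF x; destruct (HF x y) as [H1 H2].
  split; [now apply (continuity_2d_pt_section (fun s t => fst (F s t)))|
          now apply (continuity_2d_pt_section (fun s t => snd (F s t)))].
Qed.

(** * Real integrals depending on a parameter *)

Lemma continuity_pt_ex_RInt (f : R -> R) (a b : R) :
  (forall x, continuity_pt f x) -> ex_RInt f a b.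
Proof.
  intros H; apply (ex_RInt_continuous (V := R_CompleteNormedModule)).
  intros z _; apply continuity_pt_filterlim, H.
Qed.

(** Uniform continuity over the compact range of [s] bounds the change of the integrand by one
    constant when [t] is near [y]. *)
Lemma continuity_RInt_param (f : R -> R -> R) (a b : R) :
  a <= b -> (forall x y, continuity_2d_pt f x y) ->
  forall y, continuity_pt (fun t => RInt (fun s => f s t) a b) y.
Proof.
  intros Hab H y; apply continuity_pt_filterlim, filterlim_locally; intros eps.
  (* The [+ 1] keeps the quotient meaningful when [a = b] and makes the final estimate strict. *)
  assert (Hpos : 0 < eps / (b - a + 1)).
  { apply Rdiv_lt_0_compat; [apply cond_pos|lra]. }
  destruct (uniform_continuity_2d_1d f a b y (fun x _ => H x y) (mkposreal _ Hpos))
    as [d Hd].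
  exists d; intros t Ht.
  change (Rabs (t - y) < d) in Ht; apply Rabs_def2 in Ht.
  change (Rabs (RInt (fun s => f s t) a b - RInt (fun s => f s y) a b) < eps).
  assert (Hex : forall v, ex_RInt (fun s => f s v) a b).
  { intros v; apply continuity_pt_ex_RInt; intros x.
    apply continuity_2d_pt_section, H. }
  pose proof (RInt_minus (V := R_CompleteNormedModule) _ _ a b (Hex t) (Hex y)) as E.
  change (RInt (fun s => f s t - f s y) a b =
    RInt (fun s => f s t) a b - RInt (fun s => f s y) a b) in E.
  rewrite <- E.
  apply Rle_lt_trans with ((b - a) * (eps / (b - a + 1))).
  - apply abs_RInt_le_const; [exact Hab| |].
    + apply (ex_RInt_minus (V := R_NormedModule)); apply Hex.
    + intros x Hx; left; apply Hd; try lra.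
      rewrite Rminus_diag, Rabs_R0; apply cond_pos.
  - replace (pos eps) with ((b - a + 1) * (eps / (b - a + 1))) at 2 by (field; lra).
    apply Rmult_lt_compat_r; [exact Hpos|lra].
Qed.

Lemma continuity_2d_pt_swap (f : R -> R -> R) (x y : R) :
  continuity_2d_pt f x y -> continuity_2d_pt (fun t s => f s t) y x.
Proof.
  intros H eps; destruct (H eps) as [d Hd]; exists d; intros u v Hu Hv; now apply Hd.
Qed.

Lemma is_derive_RInt_upper (f : R -> R) (a x : R) :
  (forall t, continuity_pt f t) -> is_derive (fun b => RInt f a b) x (f x).
Proof.
  intros H; apply (is_derive_RInt f _ a).
  - apply filter_forall; intros b; apply (RInt_correct (V := R_CompleteNormedModule)).
    now apply continuity_pt_ex_RInt.
  - apply continuity_pt_filterlim, H.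
Qed.

Lemma is_derive_RInt_param_everywhere (f df : R -> R -> R) (a b x : R) :
  (forall s t, continuity_pt (f s) t) -> (forall s t, continuity_2d_pt df s t) ->
  (forall s t, is_derive (fun u => f u t) s (df s t)) ->
  is_derive (fun s => RInt (fun t => f s t) a b) x (RInt (fun t => df x t) a b).
Proof.
  intros Hf Hdf D.
  assert (E : forall s t, Derive (fun u => f u t) s = df s t).
  { intros; now apply is_derive_unique. }
  rewrite (RInt_ext (fun t => df x t) (fun t => Derive (fun u => f u t) x))
    by (intros; now rewrite E).
  apply is_derive_RInt_param.
  - apply filter_forall; intros s t _; eexists; apply D.
  - intros t _; apply continuity_2d_pt_ext with df; [now intros|apply Hdf].
  - apply filter_forall; intros s; apply continuity_pt_ex_RInt, Hf.
Qed.

(* Both sides, with the first upper bound variable, have derivative [RInt (f x)]. *)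
Lemma RInt_swap (f : R -> R -> R) (a b c d : R) :
  a < b -> c <= d -> (forall x y, continuity_2d_pt f x y) ->
  RInt (fun s => RInt (fun t => f s t) c d) a b =
  RInt (fun t => RInt (fun s => f s t) a b) c d.
Proof.
  intros Hab Hcd H.
  set (g := fun x => RInt (fun s => RInt (fun t => f s t) c d) a x -
                     RInt (fun t => RInt (fun s => f s t) a x) c d).
  assert (H1 : forall s t, continuity_pt (f s) t).
  { intros s t.
    now apply (continuity_2d_pt_section (fun t s => f s t)), continuity_2d_pt_swap. }
  assert (E : g a = g b).
  { apply (eq_is_derive (V := R_NormedModule)); [|exact Hab]; intros x _.
    change (is_derive g x 0).
    replace 0 with (RInt (fun t => f x t) c d - RInt (fun t => f x t) c d) by ring.
    apply (is_derive_minus (V := R_NormedModule)).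
    - apply (is_derive_RInt_upper (fun s => RInt (fun t => f s t) c d)).
      apply (continuity_RInt_param (fun t s => f s t)); [exact Hcd|].
      intros; now apply continuity_2d_pt_swap.
    - apply (is_derive_RInt_param_everywhere (fun x t => RInt (fun s => f s t) a x) f).
      (* The upper bound runs over all reals; below [a] the integral is reversed, since continuity
         in the parameter is available for ordered bounds. *)
      + intros s; destruct (Rle_dec a s) as [Has|Has].
        * now apply continuity_RInt_param.
        * intros t.
          apply continuity_pt_ext with (fun t => - RInt (fun u => f u t) s a).
          { intros u; apply (opp_RInt_swap (V := R_CompleteNormedModule)).
            apply continuity_pt_ex_RInt; intros y; now apply continuity_2d_pt_section. }
          apply continuity_pt_opp, continuity_RInt_param; [lra|exact H].
      + exact H.
      + intros s t; apply (is_derive_RInt_upper (fun u => f u t)).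
        intros y; now apply continuity_2d_pt_section. }
  unfold g in E; rewrite RInt_point in E.
  rewrite (RInt_ext (fun t => RInt (fun s => f s t) a a) (fun _ => 0)) in E
    by (intros; rewrite RInt_point; reflexivity).
  rewrite RInt_const in E.
  change (0 - (d - c) * 0 = RInt (fun s => RInt (fun t => f s t) c d) a b -
                   RInt (fun t => RInt (fun s => f s t) a b) c d) in E.
  lra.
Qed.

(** * Integrals over the circle and Cauchy's formula *)

(** Not normalised: each circle contributes [2 * PI], and the factor [/ (4 * PI * PI)] of
    [ip_integrand] compensates for both. *)
Definition CInt (f : R -> Cx) : Cx :=
  (RInt (fun t => fst (f t)) 0 (2 * PI), RInt (fun t => snd (f t)) 0 (2 * PI)).

Lemma two_PI_pos : 0 < 2 * PI.
Proof. pose proof PI_RGT_0; lra. Qed.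

Lemma CInt_ext (f g : R -> Cx) : (forall t, f t = g t) -> CInt f = CInt g.
Proof.
  intros H; replace g with f; [reflexivity|]; now apply functional_extensionality.
Qed.

Lemma cont1_ex_RInt (f : R -> Cx) : cont1 f ->
  ex_RInt (fun t => fst (f t)) 0 (2 * PI) /\ ex_RInt (fun t => snd (f t)) 0 (2 * PI).
Proof. intros H; split; apply continuity_pt_ex_RInt; intros x; apply H. Qed.

Lemma RInt_Rplus (f g : R -> R) (a b : R) : ex_RInt f a b -> ex_RInt g a b ->
  RInt (fun t => f t + g t) a b = RInt f a b + RInt g a b.
Proof. exact (RInt_plus f g a b). Qed.

Lemma RInt_Rminus (f g : R -> R) (a b : R) : ex_RInt f a b -> ex_RInt g a b ->
  RInt (fun t => f t - g t) a b = RInt f a b - RInt g a b.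
Proof. exact (RInt_minus f g a b). Qed.

Lemma CInt_add (f g : R -> Cx) : cont1 f -> cont1 g ->
  CInt (fun t => Cadd (f t) (g t)) = Cadd (CInt f) (CInt g).
Proof.
  intros Hf Hg; destruct (cont1_ex_RInt f Hf), (cont1_ex_RInt g Hg).
  apply Cx_eq; simpl; now apply RInt_Rplus.
Qed.

Lemma CInt_const (a : Cx) : CInt (fun _ => a) = Cmul (RtoC (2 * PI)) a.
Proof.
  unfold CInt; rewrite !RInt_const; apply Cx_eq; simpl;
    unfold scal; simpl; unfold mult; simpl; ring.
Qed.

Lemma CInt_mul (a : Cx) (f : R -> Cx) : cont1 f ->
  CInt (fun t => Cmul a (f t)) = Cmul a (CInt f).
Proof.
  intros Hf; destruct (cont1_ex_RInt f Hf) as [H1 H2].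
  assert (S1 : forall r, ex_RInt (fun t => r * fst (f t)) 0 (2 * PI) /\
                         ex_RInt (fun t => r * snd (f t)) 0 (2 * PI)).
  { intros r; split; now apply (ex_RInt_scal (V := R_NormedModule)). }
  assert (S2 : forall r, RInt (fun t => r * fst (f t)) 0 (2 * PI) =
      r * RInt (fun t => fst (f t)) 0 (2 * PI) /\
      RInt (fun t => r * snd (f t)) 0 (2 * PI) = r * RInt (fun t => snd (f t)) 0 (2 * PI)).
  { intros r; split; now apply (RInt_scal (V := R_CompleteNormedModule)). }
  apply Cx_eq; simpl.
  - rewrite <- (proj1 (S2 (fst a))), <- (proj2 (S2 (snd a))).
    apply RInt_Rminus; [exact (proj1 (S1 _))|exact (proj2 (S1 _))].
  - rewrite <- (proj2 (S2 (fst a))), <- (proj1 (S2 (snd a))).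
    apply RInt_Rplus; [exact (proj2 (S1 _))|exact (proj1 (S1 _))].
Qed.

Lemma CInt_conj (f : R -> Cx) : cont1 f ->
  CInt (fun t => Cconj (f t)) = Cconj (CInt f).
Proof.
  intros Hf; destruct (cont1_ex_RInt f Hf) as [H1 H2].
  apply Cx_eq; simpl; [reflexivity|].
  now apply (RInt_opp (V := R_CompleteNormedModule)).
Qed.

Lemma cont1_CInt (F : R -> R -> Cx) : cont2 F -> cont1 (fun t => CInt (fun s => F s t)).
Proof.
  intros HF y; pose proof two_PI_pos; split; simpl;
    apply (continuity_RInt_param (fun s t => _ (F s t))); try lra; intros; apply HF.
Qed.

Lemma CInt_swap (F : R -> R -> Cx) : cont2 F ->
  CInt (fun t => CInt (fun s => F s t)) = CInt (fun s => CInt (fun t => F s t)).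
Proof.
  intros HF; pose proof two_PI_pos; symmetry; apply Cx_eq; simpl;
    apply (RInt_swap (fun s t => _ (F s t))); try lra; intros; apply HF.
Qed.

(** * Derivatives of complex-valued functions of a real variable *)

Definition cderive (f : R -> Cx) (x : R) (l : Cx) : Prop :=
  is_derive (fun t => fst (f t)) x (fst l) /\ is_derive (fun t => snd (f t)) x (snd l).

Lemma cderive_ext (f g : R -> Cx) (x : R) (l l' : Cx) :
  (forall t, f t = g t) -> l = l' -> cderive f x l -> cderive g x l'.
Proof.
  intros H <- D; replace g with f; [exact D|]; now apply functional_extensionality.
Qed.

(** A function presented by two real coordinate functions lets [auto_derive] handle the product and
    inverse rules as real computations. *)
Lemma complex_function_ind (P : (R -> Cx) -> Prop) :
  (forall f1 f2 : R -> R, P (fun t => (f1 t, f2 t))) -> forall f, P f.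
Proof.
  intros H f; replace f with (fun t => (fst (f t), snd (f t))); [apply H|].
  apply functional_extensionality; intros t; now destruct (f t).
Qed.

Ltac split_derive :=
  intros; unfold cderive in *; simpl in *;
  repeat match goal with H : _ /\ _ |- _ => destruct H end;
  split; auto_derive;
  repeat match goal with |- _ /\ _ => split end; try exact I;
  try (eexists; eassumption);
  repeat match goal with H : is_derive ?f ?x ?l |- _ =>
    rewrite (is_derive_unique f x l H); clear H end.

Lemma cderive_const (a : Cx) (x : R) : cderive (fun _ => a) x C0.
Proof. split; apply (is_derive_const (V := R_NormedModule)). Qed.

Lemma cderive_add (f g : R -> Cx) (x : R) (l l' : Cx) :
  cderive f x l -> cderive g x l' -> cderive (fun t => Cadd (f t) (g t)) x (Cadd l l').
Proof.
  induction f as [f1 f2] using complex_function_ind.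
  induction g as [g1 g2] using complex_function_ind.
  split_derive; ring.
Qed.

Lemma cderive_mul (f g : R -> Cx) (x : R) (l l' : Cx) :
  cderive f x l -> cderive g x l' ->
  cderive (fun t => Cmul (f t) (g t)) x (Cadd (Cmul l (g x)) (Cmul (f x) l')).
Proof.
  induction f as [f1 f2] using complex_function_ind.
  induction g as [g1 g2] using complex_function_ind.
  split_derive; ring.
Qed.

Lemma cderive_inv (f : R -> Cx) (x : R) (l : Cx) :
  f x <> C0 -> cderive f x l ->
  cderive (fun t => Cinv (f t)) x (Copp (Cdiv l (Cmul (f x) (f x)))).
Proof.
  induction f as [f1 f2] using complex_function_ind.
  intros H0; pose proof (Cnorm2_pos _ H0) as HN; unfold Cnorm2 in HN.
  simpl in HN.
  (* This is [|f x ^ 2| ^ 2 = |f x| ^ 4], the denominator that comes from dividing by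
     [Cmul (f x) (f x)]. *)
  assert (HM : (f1 x * f1 x - f2 x * f2 x) * (f1 x * f1 x - f2 x * f2 x) +
    (f1 x * f2 x + f2 x * f1 x) * (f1 x * f2 x + f2 x * f1 x) <> 0).
  { apply Rgt_not_eq.
    replace (_ + _) with ((f1 x * f1 x + f2 x * f2 x) * (f1 x * f1 x + f2 x * f2 x))
      by ring.
    nra. }
  unfold Cdiv, Cinv, Cnorm2; split_derive; try lra; field; split; lra.
Qed.

Lemma CInt_derive (f f' : R -> Cx) :
  (forall x, cderive f x (f' x)) -> cont1 f' -> f 0 = f (2 * PI) -> CInt f' = C0.
Proof.
  intros D Hc E.
  apply Cx_eq; simpl; apply is_RInt_unique.
  - replace 0 with (minus (fst (f (2 * PI))) (fst (f 0))) at 2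
      by (rewrite E; apply (minus_eq_zero (G := R_AbelianGroup))).
    apply (is_RInt_derive (fun t => fst (f t))); intros x _; [apply D|].
    apply continuity_pt_filterlim, Hc.
  - replace 0 with (minus (snd (f (2 * PI))) (snd (f 0))) at 2
      by (rewrite E; apply (minus_eq_zero (G := R_AbelianGroup))).
    apply (is_RInt_derive (fun t => snd (f t))); intros x _; [apply D|].
    apply continuity_pt_filterlim, Hc.
Qed.

Lemma cderive_CInt (F dF : R -> R -> Cx) (x : R) :
  cont2 F -> cont2 dF -> (forall s t, cderive (fun u => F u t) s (dF s t)) ->
  cderive (fun s => CInt (fun t => F s t)) x (CInt (fun t => dF x t)).
Proof.
  intros HF HdF D; split; simpl.
  - apply (is_derive_RInt_param_everywhere (fun s t => fst (F s t)) (fun s t => fst (dF s t)));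
      intros s t; [|apply HdF|apply D].
    apply (continuity_2d_pt_section (fun t s => fst (F s t))), continuity_2d_pt_swap, HF.
  - apply (is_derive_RInt_param_everywhere (fun s t => snd (F s t)) (fun s t => snd (dF s t)));
      intros s t; [|apply HdF|apply D].
    apply (continuity_2d_pt_section (fun t s => snd (F s t))), continuity_2d_pt_swap, HF.
Qed.

Lemma cderive_zero_const (f : R -> Cx) (a b : R) :
  a < b -> (forall x, cderive f x C0) -> f a = f b.
Proof.
  intros Hab D; apply Cx_eq;
    [apply (eq_is_derive (V := R_NormedModule) (fun t => fst (f t))) |
     apply (eq_is_derive (V := R_NormedModule) (fun t => snd (f t)))];
    auto; intros t _; apply D.
Qed.

(** * Holomorphy along contractions of the circle *)

(* The parameter is [sin s ^ 2] rather than [s], so that the contraction of the circle to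
   its centre [a] stays in the closed disc and is smooth for all real [s]. *)
Definition contraction (a : Cx) (s t : R) : Cx :=
  Cadd a (Cmul (RtoC (sin s * sin s)) (Csub (Cexpi t) a)).

(** [F'] stands for the complex derivative at the contracted point. The factors following it are the
    [s]- and [t]-derivatives of [contraction a]; that one [F'] serves both directions is the content
    of the Cauchy-Riemann equations. The equality at [0] and [2 * PI] expresses that the curve is
    closed. *)
Definition holo_along (a : Cx) (F : R -> R -> Cx) : Prop :=
  cont2 F /\ (forall s, F s 0 = F s (2 * PI)) /\
  exists F', cont2 F' /\ forall s t,
    cderive (fun u => F u t) s
      (Cmul (F' s t) (Cmul (RtoC (2 * sin s * cos s)) (Csub (Cexpi t) a))) /\
    cderive (fun u => F s u) t
      (Cmul (F' s t) (Cmul (RtoC (sin s * sin s)) (Cmul (0, 1) (Cexpi t)))).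

Definition disc_holo (f : Cx -> Cx) : Prop :=
  forall a, Cnorm2 a < 1 -> holo_along a (fun s t => f (contraction a s t)).

Lemma Cexpi_2PI : Cexpi (2 * PI) = Cexpi 0.
Proof. unfold Cexpi; now rewrite cos_2PI, sin_2PI, cos_0, sin_0. Qed.

Lemma cont2_Cexpi_fst : cont2 (fun s t => Cexpi s).
Proof.
  replace (fun s t : R => Cexpi s) with (fun s t : R => Cexpi (1 * s)).
  - apply cont2_Cexpi1.
  - apply functional_extensionality; intros s; now rewrite Rmult_1_l.
Qed.

Lemma cont2_Cexpi_snd : cont2 (fun s t => Cexpi t).
Proof. apply (cont2_swap (fun s t => Cexpi s)), cont2_Cexpi_fst. Qed.

Lemma cont2_contraction (a : Cx) : cont2 (contraction a).
Proof.
  unfold contraction; apply cont2_add; [apply cont2_const|].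
  apply cont2_mul; [|apply cont2_sub; [apply cont2_Cexpi_snd|apply cont2_const]].
  intros x y; split; simpl; [|apply continuity_2d_pt_const].
  destruct (cont2_Cexpi_fst x y) as [_ H]; now apply continuity_2d_pt_mult.
Qed.

Lemma disc_holo_const (b : Cx) : disc_holo (fun _ => b).
Proof.
  intros a _; split; [apply cont2_const|split; [reflexivity|]].
  exists (fun _ _ => C0); split; [apply cont2_const|].
  intros s t; split; (eapply cderive_ext; [| |apply cderive_const]);
    [reflexivity|ring|reflexivity|ring].
Qed.

Lemma disc_holo_id : disc_holo (fun z => z).
Proof.
  intros a _; split; [apply cont2_contraction|split].
  - intros s; unfold contraction; now rewrite Cexpi_2PI.
  - exists (fun _ _ => C1); split; [apply cont2_const|].
    intros s t; split; unfold contraction, cderive; simpl;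
      split; auto_derive; auto; simpl; ring.
Qed.

Lemma disc_holo_add (f g : Cx -> Cx) :
  disc_holo f -> disc_holo g -> disc_holo (fun z => Cadd (f z) (g z)).
Proof.
  intros Hf Hg a Ha.
  destruct (Hf a Ha) as (Cf & Pf & f' & Cf' & Df).
  destruct (Hg a Ha) as (Cg & Pg & g' & Cg' & Dg).
  split; [now apply cont2_add|split; [intros s; now rewrite Pf, Pg|]].
  exists (fun s t => Cadd (f' s t) (g' s t)); split; [now apply cont2_add|].
  intros s t; destruct (Df s t) as [D1 D2], (Dg s t) as [D3 D4]; split.
  - eapply cderive_ext; [| |exact (cderive_add _ _ _ _ _ D1 D3)]; [reflexivity|ring].
  - eapply cderive_ext; [| |exact (cderive_add _ _ _ _ _ D2 D4)]; [reflexivity|ring].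
Qed.

Lemma disc_holo_mul (f g : Cx -> Cx) :
  disc_holo f -> disc_holo g -> disc_holo (fun z => Cmul (f z) (g z)).
Proof.
  intros Hf Hg a Ha.
  destruct (Hf a Ha) as (Cf & Pf & f' & Cf' & Df).
  destruct (Hg a Ha) as (Cg & Pg & g' & Cg' & Dg).
  split; [now apply cont2_mul|split; [intros s; now rewrite Pf, Pg|]].
  exists (fun s t => Cadd (Cmul (f' s t) (g (contraction a s t)))
                          (Cmul (f (contraction a s t)) (g' s t))).
  split; [apply cont2_add; now apply cont2_mul|].
  intros s t; destruct (Df s t) as [D1 D2], (Dg s t) as [D3 D4]; split.
  - eapply cderive_ext; [| |exact (cderive_mul _ _ _ _ _ D1 D3)]; [reflexivity|cbv beta; ring].
  - eapply cderive_ext; [| |exact (cderive_mul _ _ _ _ _ D2 D4)]; [reflexivity|cbv beta; ring].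
Qed.

(** Convexity of the disc, made explicit with [r = sin s ^ 2]: [|(1-r) a + r w|^2 = (1-r) |a|^2 + r
    |w|^2 - r (1-r) |w - a|^2]. *)
Lemma Cnorm2_contraction (a : Cx) (s t : R) :
  Cnorm2 a < 1 -> Cnorm2 (contraction a s t) <= 1.
Proof.
  unfold Cnorm2, contraction; destruct a as [x y]; simpl; intros H.
  pose proof (sin2_cos2 t) as H1; unfold Rsqr in H1.
  pose proof (sin2_cos2 s) as H2; unfold Rsqr in H2.
  assert (Hr : 0 <= sin s * sin s <= 1) by nra.
  set (r := sin s * sin s) in *; clearbody r.
  assert (0 <= r * (1 - r) * ((cos t - x) * (cos t - x) + (sin t - y) * (sin t - y))) by
    (apply Rmult_le_pos; [nra|apply Rplus_le_le_0_compat; apply Rle_0_sqr]).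
  match goal with |- ?l <= 1 => replace l with
    ((1 - r) * (x * x + y * y) + r * (sin t * sin t + cos t * cos t) -
     r * (1 - r) * ((cos t - x) * (cos t - x) + (sin t - y) * (sin t - y))) by ring end.
  rewrite H1; nra.
Qed.

(** Contracted points stay in the closed disc, so a function without zeros there can be inverted
    along the whole contraction. Stability is used through this lemma. *)
Lemma disc_holo_inv (f : Cx -> Cx) :
  disc_holo f -> (forall z, Cnorm2 z <= 1 -> f z <> C0) ->
  disc_holo (fun z => Cinv (f z)).
Proof.
  intros Hf H0 a Ha.
  destruct (Hf a Ha) as (Cf & Pf & f' & Cf' & Df).
  assert (N0 : forall s t, f (contraction a s t) <> C0).
  { intros; now apply H0, Cnorm2_contraction. }
  split; [now apply cont2_inv|split; [intros s; now rewrite Pf|]].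
  exists (fun s t => Copp (Cdiv (f' s t)
    (Cmul (f (contraction a s t)) (f (contraction a s t))))).
  split.
  { apply cont2_opp, cont2_div; [assumption|now apply cont2_mul|].
    intros; now apply Cmul_neq0. }
  intros s t; destruct (Df s t) as [D1 D2]; split.
  - eapply cderive_ext; [| |apply cderive_inv; [|exact D1]; apply N0];
      [reflexivity|cbv beta; field; apply N0].
  - eapply cderive_ext; [| |apply cderive_inv; [|exact D2]; apply N0];
      [reflexivity|cbv beta; field; apply N0].
Qed.

(** * Mean value property and Cauchy's formula on the unit circle *)

Lemma Cexpi_norm (t : R) : Cnorm2 (Cexpi t) = 1.
Proof.
  unfold Cnorm2; simpl; pose proof (sin2_cos2 t) as H; unfold Rsqr in H; lra.
Qed.

Lemma Cexpi_sub_neq0 (a : Cx) (t : R) : Cnorm2 a < 1 -> Csub (Cexpi t) a <> C0.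
Proof.
  intros Ha E; pose proof (Cexpi_norm t) as H.
  replace (Cexpi t) with (Cadd (Csub (Cexpi t) a) a) in H by ring.
  rewrite E in H; unfold Cnorm2 in *; simpl in H; lra.
Qed.

(* With [K = w / (w - a)], the derivative in [s] of the contracted integral is a multiple
   of the integral of the derivative in [t], which vanishes by periodicity. *)
Lemma CInt_kernel_factor (f : Cx -> Cx) (a : Cx) :
  disc_holo f -> Cnorm2 a < 1 ->
  CInt (fun t => Cmul (f (Cexpi t)) (Cdiv (Cexpi t) (Csub (Cexpi t) a))) =
  Cmul (f a) (CInt (fun t => Cdiv (Cexpi t) (Csub (Cexpi t) a))).
Proof.
  intros Hf Ha.
  destruct (Hf a Ha) as (Cf & Pf & f' & Cf' & Df).
  set (K := fun t => Cdiv (Cexpi t) (Csub (Cexpi t) a)).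
  assert (CK : cont2 (fun _ t => K t)).
  { apply cont2_div; [apply cont2_Cexpi_snd| |intros; now apply Cexpi_sub_neq0].
    apply cont2_sub; [apply cont2_Cexpi_snd|apply cont2_const]. }
  assert (CK1 : cont1 K) by exact (cont2_cont1 _ 0 (cont2_swap _ CK)).
  set (F := fun s t => Cmul (f (contraction a s t)) (K t)).
  (* At [s = 0] the contracted circle is the point [a]; at [s = PI / 2] it is the unit circle
     itself. *)
  assert (E : CInt (F 0) = CInt (F (PI / 2))).
  { apply (cderive_zero_const (fun s => CInt (F s))); [pose proof PI_RGT_0; lra|].
    intros s.
    assert (C1w : cont1 (fun t => Cmul (f' s t) (Cexpi t))).
    { apply (cont2_cont1 (fun t s => Cmul (f' s t) (Cexpi t))).
      apply (cont2_swap (fun s t => Cmul (f' s t) (Cexpi t))).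
      apply cont2_mul; [assumption|apply cont2_Cexpi_snd]. }
    assert (HCsc : forall g : R -> R, (forall x, continuity_pt g x) ->
              cont2 (fun s t => RtoC (g s))).
    { intros g Hg x y; split; simpl; [|apply continuity_2d_pt_const].
      apply (continuity_1d_2d_pt_comp g (fun s t => s)); [apply Hg|].
      apply continuity_2d_pt_id1. }
    (* The kernel cancels the factor [Csub (Cexpi t) a] of the [s]-derivative. What remains,
       [f' * Cexpi t], is proportional to the [t]-derivative. *)
    eapply cderive_ext; [reflexivity| |
      apply (cderive_CInt F (fun s t => Cmul (RtoC (2 * sin s * cos s))
        (Cmul (f' s t) (Cexpi t))))].
    - rewrite CInt_mul by assumption.
      (* The [t]-derivative carries [sin s ^ 2], which can only be divided out when nonzero;
         otherwise the factor [2 * sin s * cos s] already vanishes. *)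
      destruct (Req_dec (sin s) 0) as [Hs|Hs].
      { rewrite Hs; replace (2 * 0 * cos s) with 0 by ring; apply Cx_eq; simpl; ring. }
      replace (CInt (fun t => Cmul (f' s t) (Cexpi t))) with C0; [ring|].
      assert (Z : CInt (fun t => Cmul (Cmul (RtoC (sin s * sin s)) (0, 1))
                                      (Cmul (f' s t) (Cexpi t))) = C0).
      { apply (CInt_derive (fun t => f (contraction a s t))).
        - intros t; eapply cderive_ext; [| |apply (proj2 (Df s t))];
            [reflexivity|cbv beta; ring].
        - apply (cont2_cont1 (fun t s0 => Cmul (Cmul (RtoC (sin s * sin s)) (0, 1))
                                      (Cmul (f' s t) (Cexpi t))) 0).
          apply cont2_mul; [apply cont2_const|].
          intros x y; apply (cont2_swap (fun _ t => Cmul (f' s t) (Cexpi t))).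
          clear x y; intros x y.
          destruct (C1w y); split;
            (apply (continuity_1d_2d_pt_comp (fun t => _ (Cmul (f' s t) (Cexpi t)))
               (fun s t => t)); [assumption|apply continuity_2d_pt_id2]).
        - apply Pf. }
      rewrite CInt_mul in Z by assumption.
      symmetry.
      set (I := CInt _) in *.
      assert (N : Cmul (RtoC (sin s * sin s)) (0, 1) <> C0).
      { apply Cmul_neq0; [apply RtoC_neq0; nra|intros H; injection H; lra]. }
      replace I with (Cmul (Cinv (Cmul (RtoC (sin s * sin s)) (0, 1)))
        (Cmul (Cmul (RtoC (sin s * sin s)) (0, 1)) I)).
      { rewrite Z; ring. }
      set (q := Cmul (RtoC _) _) in *; field; exact N.
    - now apply cont2_mul.
    - apply cont2_mul; [|apply cont2_mul; [assumption|apply cont2_Cexpi_snd]].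
      apply (HCsc (fun s => 2 * sin s * cos s)); intros x; reg.
    - intros u t; unfold F.
      eapply cderive_ext; [reflexivity| |apply cderive_mul;
        [apply (proj1 (Df u t))|apply cderive_const]].
      cbv beta; unfold K; field; now apply Cexpi_sub_neq0. }
  symmetry.
  rewrite <- CInt_mul by assumption.
  transitivity (CInt (F 0)); [|rewrite E]; apply CInt_ext; intros t; unfold F, contraction.
  - rewrite sin_0; do 2 f_equal; apply Cx_eq; simpl; ring.
  - rewrite sin_PI2; do 2 f_equal; apply Cx_eq; simpl; ring.
Qed.

Lemma Cexpi_neq0 (t : R) : Cexpi t <> C0.
Proof.
  intros E; pose proof (Cexpi_norm t) as H; rewrite E in H; unfold Cnorm2 in H; simpl in H; lra.
Qed.

Lemma Cnorm2_C0 : Cnorm2 C0 < 1.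
Proof. unfold Cnorm2; simpl; lra. Qed.

(** With pole [C0] the kernel is identically [1], so its integral is known outright. The kernel
    integral for a general pole is deduced from this case, hence the order of the results. *)
Lemma mean_value_circle (f : Cx -> Cx) :
  disc_holo f -> CInt (fun t => f (Cexpi t)) = Cmul (RtoC (2 * PI)) (f C0).
Proof.
  intros Hf.
  assert (K1 : forall t, Cdiv (Cexpi t) (Csub (Cexpi t) C0) = C1).
  { intros t; field.
    replace (Csub (Cexpi t) C0) with (Cexpi t) by ring; apply Cexpi_neq0. }
  rewrite (CInt_ext _ (fun t => Cmul (f (Cexpi t)) (Cdiv (Cexpi t) (Csub (Cexpi t) C0))))
    by (intros; rewrite K1; ring).
  rewrite CInt_kernel_factor by (assumption || apply Cnorm2_C0).
  rewrite (CInt_ext _ (fun _ => C1)) by assumption.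
  rewrite CInt_const; ring.
Qed.

Lemma Cconj_Cexpi (t : R) : Cconj (Cexpi t) = Cinv (Cexpi t).
Proof.
  unfold Cinv; rewrite Cexpi_norm; apply Cx_eq; simpl; field.
Qed.

Lemma one_sub_mul_neq0 (a z : Cx) :
  Cnorm2 a < 1 -> Cnorm2 z <= 1 -> Csub C1 (Cmul a z) <> C0.
Proof.
  intros Ha Hz E.
  assert (E' : Cmul a z = C1).
  { replace (Cmul a z) with (Csub C1 (Csub C1 (Cmul a z))) by ring.
    rewrite E; ring. }
  assert (H : Cnorm2 (Cmul a z) = Cnorm2 a * Cnorm2 z) by (unfold Cnorm2; simpl; ring).
  rewrite E' in H; unfold Cnorm2 at 1 in H; simpl in H.
  assert (0 <= Cnorm2 a) by (unfold Cnorm2; nra).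
  assert (0 <= Cnorm2 z) by (unfold Cnorm2; nra).
  nra.
Qed.

Lemma disc_holo_one_sub_mul (a : Cx) : disc_holo (fun z => Csub C1 (Cmul a z)).
Proof.
  apply (disc_holo_add (fun _ => C1) (fun z => Copp (Cmul a z))); [apply disc_holo_const|].
  replace (fun z => Copp (Cmul a z)) with (fun z => Cmul (Copp a) z)
    by (apply functional_extensionality; intros z; ring).
  apply disc_holo_mul; [apply disc_holo_const|apply disc_holo_id].
Qed.

(** On the circle [w / (w - a)] is the conjugate of [1 / (1 - conj a * w)], which is holomorphic on
    the closed disc with value [1] at the centre. *)
Lemma CInt_kernel (a : Cx) : Cnorm2 a < 1 ->
  CInt (fun t => Cdiv (Cexpi t) (Csub (Cexpi t) a)) = RtoC (2 * PI).
Proof.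
  intros Ha.
  set (f := fun z => Cinv (Csub C1 (Cmul (Cconj a) z))).
  assert (N : forall z, Cnorm2 z <= 1 -> Csub C1 (Cmul (Cconj a) z) <> C0).
  { intros z; apply one_sub_mul_neq0; unfold Cnorm2 in *; simpl; lra. }
  assert (Hf : disc_holo f) by (apply disc_holo_inv; [apply disc_holo_one_sub_mul|exact N]).
  assert (CF : cont1 (fun t => f (Cexpi t))).
  { apply (cont2_cont1 (fun t _ : R => f (Cexpi t)) 0); unfold f.
    apply cont2_inv; [|intros; apply N; rewrite Cexpi_norm; lra].
    apply cont2_sub; [apply cont2_const|].
    apply cont2_mul; [apply cont2_const|apply cont2_Cexpi_fst]. }
  rewrite (CInt_ext _ (fun t => Cconj (f (Cexpi t)))).
  - rewrite CInt_conj by exact CF.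
    rewrite mean_value_circle by exact Hf.
    rewrite Cconj_mul, Cconj_RtoC; unfold f.
    replace (Csub C1 (Cmul (Cconj a) C0)) with C1 by ring.
    replace (Cconj (Cinv C1)) with C1; [ring|].
    apply Cx_eq; unfold Cinv, Cnorm2; simpl; field.
  - intros t; unfold f.
    assert (H1 := Cexpi_sub_neq0 a t Ha); assert (H2 := Cexpi_neq0 t).
    rewrite Cconj_inv, Cconj_sub, Cconj_mul, Cconj_invol, Cconj_Cexpi.
    replace (Cconj C1) with C1 by (apply Cx_eq; simpl; ring).
    field; split; auto.
Qed.

Lemma cauchy_circle (f : Cx -> Cx) (a : Cx) :
  disc_holo f -> Cnorm2 a < 1 ->
  CInt (fun t => Cmul (f (Cexpi t)) (Cdiv (Cexpi t) (Csub (Cexpi t) a))) =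
  Cmul (RtoC (2 * PI)) (f a).
Proof.
  intros Hf Ha; rewrite CInt_kernel_factor, CInt_kernel by assumption; ring.
Qed.

Lemma disc_holo_pow (k : nat) : disc_holo (fun z => Cpow z k).
Proof.
  induction k as [|k IH]; simpl; [apply disc_holo_const|].
  now apply disc_holo_mul; [apply disc_holo_id|].
Qed.

Lemma disc_holo_sum (N : nat) (f : nat -> Cx -> Cx) :
  (forall k, disc_holo (f k)) -> disc_holo (fun z => Csum N (fun k => f k z)).
Proof.
  intros Hf; induction N as [|N IH]; simpl;
    [apply disc_holo_const|now apply disc_holo_add].
Qed.

Lemma disc_holo_peval_fst (n m : nat) (c : nat -> nat -> Cx) (w : Cx) :
  disc_holo (fun z => peval n m c z w).
Proof.
  apply (disc_holo_sum (S n) (fun i z => Csum (S m) (fun j =>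
    Cmul (c i j) (Cmul (Cpow z i) (Cpow w j))))); intros i.
  apply (disc_holo_sum (S m) (fun j z => Cmul (c i j) (Cmul (Cpow z i) (Cpow w j)))).
  intros j; apply disc_holo_mul; [apply disc_holo_const|].
  apply disc_holo_mul; [apply disc_holo_pow|apply disc_holo_const].
Qed.

Lemma disc_holo_peval_snd (n m : nat) (c : nat -> nat -> Cx) (z : Cx) :
  disc_holo (fun w => peval n m c z w).
Proof.
  apply (disc_holo_sum (S n) (fun i w => Csum (S m) (fun j =>
    Cmul (c i j) (Cmul (Cpow z i) (Cpow w j))))); intros i.
  apply (disc_holo_sum (S m) (fun j w => Cmul (c i j) (Cmul (Cpow z i) (Cpow w j)))).
  intros j; apply disc_holo_mul; [apply disc_holo_const|].
  apply disc_holo_mul; [apply disc_holo_const|apply disc_holo_pow].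
Qed.

(** * Integrals over the torus *)

Definition DInt (F : R -> R -> Cx) : Cx := CInt (fun ph => CInt (fun th => F th ph)).

Lemma cont2_lin (x y : Cx) (F G : R -> R -> Cx) : cont2 F -> cont2 G ->
  cont2 (fun s t => Cadd (Cmul x (F s t)) (Cmul y (G s t))).
Proof.
  intros HF HG; apply cont2_add; (apply cont2_mul; [apply cont2_const|assumption]).
Qed.

Lemma CInt_lin (x y : Cx) (f g : R -> Cx) : cont1 f -> cont1 g ->
  CInt (fun t => Cadd (Cmul x (f t)) (Cmul y (g t))) =
  Cadd (Cmul x (CInt f)) (Cmul y (CInt g)).
Proof.
  intros Hf Hg.
  assert (H : forall u h, cont1 h -> cont1 (fun t => Cmul u (h t))).
  { intros u h Hh.
    apply (cont2_cont1 (fun t _ => Cmul u (h t)) 0), cont2_mul; [apply cont2_const|].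
    intros s t; destruct (Hh s); split;
      (apply (continuity_1d_2d_pt_comp (fun t => _ (h t)) (fun s _ => s));
       [assumption|apply continuity_2d_pt_id1]). }
  rewrite CInt_add by auto; now rewrite !CInt_mul.
Qed.

Lemma DInt_lin (x y : Cx) (F G : R -> R -> Cx) : cont2 F -> cont2 G ->
  DInt (fun s t => Cadd (Cmul x (F s t)) (Cmul y (G s t))) =
  Cadd (Cmul x (DInt F)) (Cmul y (DInt G)).
Proof.
  intros HF HG; unfold DInt.
  rewrite <- CInt_lin by now apply cont1_CInt.
  apply CInt_ext; intros t; apply CInt_lin; now apply cont2_cont1.
Qed.

Lemma DInt_first_zero (F : R -> R -> Cx) :
  (forall ph, CInt (fun th => F th ph) = C0) -> DInt F = C0.
Proof.
  intros H; unfold DInt; rewrite (CInt_ext _ (fun _ => C0)) by assumption.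
  rewrite CInt_const; ring.
Qed.

(** Since [w] is the outer variable of [DInt], integrating in [w] for fixed [z] goes through
    [CInt_swap]. *)
Lemma DInt_second (F : R -> R -> Cx) (g : R -> Cx) : cont2 F ->
  (forall th, CInt (fun ph => F th ph) = g th) -> DInt F = CInt g.
Proof. intros HF H; unfold DInt; rewrite CInt_swap by assumption; now apply CInt_ext. Qed.

(** [Int2] asks for integrability at both levels: the sections are continuous, and so is the inner
    integral as a function of [ph]. *)
Lemma Int2_of_continuous (F : R -> R -> R) : (forall s t, continuity_2d_pt F s t) ->
  Int2 F (RInt (fun ph => RInt (fun th => F th ph) 0 (2 * PI)) 0 (2 * PI)).
Proof.
  intros HF; pose proof two_PI_pos.
  assert (H1 : forall ph, ex_RInt (fun th => F th ph) 0 (2 * PI)).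
  { intros ph; apply continuity_pt_ex_RInt; intros th; now apply continuity_2d_pt_section. }
  exists (fun ph => ex_RInt_Reals_0 _ _ _ (H1 ph)).
  assert (H2 : ex_RInt (fun ph => RiemannInt (ex_RInt_Reals_0 _ _ _ (H1 ph))) 0 (2 * PI)).
  { apply ex_RInt_ext with (fun ph => RInt (fun th => F th ph) 0 (2 * PI)).
    - intros; apply RInt_Reals.
    - apply continuity_pt_ex_RInt, continuity_RInt_param; [lra|assumption]. }
  exists (ex_RInt_Reals_0 _ _ _ H2).
  rewrite <- RInt_Reals; apply RInt_ext; intros; symmetry; apply RInt_Reals.
Qed.

Lemma orthogonal_of_DInt (n m : nat) (c : nat -> nat -> Cx) (f : Cx -> Cx -> Cx)
  (g : R -> R -> Cx) :
  cont2 (ip_integrand n m c f g) -> DInt (ip_integrand n m c f g) = C0 ->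
  orthogonal n m c f g.
Proof.
  intros HF H; split.
  - replace 0 with (fst (DInt (ip_integrand n m c f g))) by (now rewrite H).
    apply (Int2_of_continuous (fun s t => fst (ip_integrand n m c f g s t))).
    intros s t; apply HF.
  - replace 0 with (snd (DInt (ip_integrand n m c f g))) by (now rewrite H).
    apply (Int2_of_continuous (fun s t => snd (ip_integrand n m c f g s t))).
    intros s t; apply HF.
Qed.

(** * Characters of the circle *)

(** The power [z^i] on the circle for every integer [i], where [Cpow] only has natural exponents;
    conjugation changes the sign of [i]. *)
Definition ez (i : Z) (t : R) : Cx := Cexpi (IZR i * t).

Lemma Cexpi_add (x y : R) : Cexpi (x + y) = Cmul (Cexpi x) (Cexpi y).
Proof. unfold Cexpi; rewrite cos_plus, sin_plus; apply Cx_eq; simpl; ring. Qed.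

Lemma ez_add (i j : Z) (t : R) : ez (i + j) t = Cmul (ez i t) (ez j t).
Proof. unfold ez; rewrite <- Cexpi_add, plus_IZR; f_equal; ring. Qed.

Lemma ez_nat (k : nat) (t : R) : ez (Z.of_nat k) t = Cpow (Cexpi t) k.
Proof.
  induction k as [|k IH].
  - unfold ez, Cexpi; simpl; rewrite Rmult_0_l, cos_0, sin_0; reflexivity.
  - rewrite Nat2Z.inj_succ; unfold Z.succ; rewrite ez_add, IH.
    unfold ez; rewrite Rmult_1_l; simpl; ring.
Qed.

Lemma Cconj_ez (i : Z) (t : R) : Cconj (ez i t) = ez (- i) t.
Proof.
  unfold ez, Cexpi; rewrite opp_IZR, Ropp_mult_distr_l_reverse, cos_neg, sin_neg.
  reflexivity.
Qed.

Lemma cont2_ez_fst (i : Z) : cont2 (fun th _ => ez i th).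
Proof. apply cont2_Cexpi1. Qed.

Lemma cont1_ez (i : Z) : cont1 (ez i).
Proof. exact (cont2_cont1 (fun th _ => ez i th) 0 (cont2_ez_fst i)). Qed.

Lemma cont2_ez_snd (i : Z) : cont2 (fun _ ph => ez i ph).
Proof. apply cont2_Cexpi2. Qed.

Lemma mono_ez (i j : Z) (th ph : R) : mono i j th ph = Cmul (ez i th) (ez j ph).
Proof. apply Cexpi_add. Qed.

Lemma CInt_ez_pos (i : Z) : (0 < i)%Z -> CInt (ez i) = C0.
Proof.
  intros Hi; replace i with (Z.of_nat (S (Z.to_nat (i - 1)))) by lia.
  rewrite (CInt_ext _ (fun t => Cpow (Cexpi t) (S (Z.to_nat (i - 1)))))
    by (intros; apply ez_nat).
  rewrite (mean_value_circle _ (disc_holo_pow _)); simpl; ring.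
Qed.

Lemma CInt_ez (i : Z) : CInt (ez i) = if Z.eq_dec i 0 then RtoC (2 * PI) else C0.
Proof.
  destruct (Z.eq_dec i 0) as [->|Hi].
  - rewrite (CInt_ext _ (fun _ => C1)) by (intros t; apply (ez_nat 0)).
    rewrite CInt_const; ring.
  - destruct (Z_lt_le_dec 0 i) as [H|H]; [now apply CInt_ez_pos|].
    rewrite (CInt_ext _ (fun t => Cconj (ez (- i) t)))
      by (intros t; rewrite Cconj_ez; f_equal; lia).
    rewrite CInt_conj by apply cont1_ez.
    rewrite CInt_ez_pos by lia; apply Cx_eq; simpl; ring.
Qed.

(** * Moments of the two terms of [L] *)

(* On the torus, with [eta = r] real, [z^-i w^-j L / |p|^2] is the conjugate of
   [analytic_part] minus [coanalytic_part]: the first uses [1 / |p|^2 = 1 / (p (conj p))]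
   and the second [p~ = z^n w^m (conj p)]. *)
Definition analytic_part (n m : nat) (c : nat -> nat -> Cx) (r : R) (i j : Z)
  (th ph : R) : Cx :=
  let z := Cexpi th in let w := Cexpi ph in
  Cmul (Cmul (Cmul (ez (i - Z.of_nat n) th) (ez j ph))
             (Cdiv (peval n m c z (RtoC r)) (peval n m c z w)))
       (Cdiv w (Csub w (RtoC r))).

Definition coanalytic_part (n m : nat) (c : nat -> nat -> Cx) (r : R) (i j : Z)
  (th ph : R) : Cx :=
  let z := Cexpi th in let w := Cexpi ph in
  Cdiv (Cmul (Cmul (ez (Z.of_nat n - i) th) (ez (Z.of_nat m - j) ph))
             (Cmul (Cpow (RtoC r) m) (peval n m c z (RtoC (/ r)))))
       (Cmul (peval n m c z w) (Csub C1 (Cmul (RtoC r) w))).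

Lemma Cnorm2_RtoC (r : R) : 0 < r < 1 -> Cnorm2 (RtoC r) < 1.
Proof. unfold Cnorm2; simpl; nra. Qed.

Lemma stable_torus (n m : nat) (c : nat -> nat -> Cx) (th ph : R) :
  stable n m c -> peval n m c (Cexpi th) (Cexpi ph) <> C0.
Proof. intros H; apply H; rewrite Cexpi_norm; lra. Qed.

Lemma Cpow_neq0 (a : Cx) (k : nat) : a <> C0 -> Cpow a k <> C0.
Proof.
  intros H; induction k as [|k IH]; [intros E; injection E; lra|].
  now apply Cmul_neq0.
Qed.

(** On the circle [1 / conj z = z], so each reflection in [z] only conjugates; reflecting [eta = r]
    gives the argument [1 / r]. Of the three powers [z^n], [z^n] and [conj z^n] in the second term,
    one [z^n] survives. *)
Lemma Lformula_torus (n m : nat) (c : nat -> nat -> Cx) (r : R) (i j : Z) (th ph : R) :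
  stable n m c -> 0 < r < 1 ->
  Cscale (/ (4 * PI * PI) * / Cnorm2 (peval n m c (Cexpi th) (Cexpi ph)))
    (Cmul (Lformula n m c (Cexpi th) (Cexpi ph) (RtoC r)) (Cconj (mono i j th ph))) =
  Cmul (RtoC (/ (4 * PI * PI)))
    (Csub (Cconj (analytic_part n m c r i j th ph)) (coanalytic_part n m c r i j th ph)).
Proof.
  intros Hs Hr.
  assert (HP := stable_torus n m c th ph Hs).
  assert (HP' := Cconj_neq0 _ HP).
  assert (HN := Rgt_not_eq _ _ (Cnorm2_pos _ HP)).
  assert (Hz := Cexpi_neq0 th); assert (Hw := Cexpi_neq0 ph).
  assert (Hzn := Cpow_neq0 _ n Hz).
  assert (Hr0 : RtoC r <> C0) by (apply RtoC_neq0; lra).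
  assert (H1 : Csub C1 (Cmul (RtoC r) (Cexpi ph)) <> C0).
  { apply one_sub_mul_neq0; [now apply Cnorm2_RtoC|rewrite Cexpi_norm; lra]. }
  assert (Inv : forall t, Cinv (Cconj (Cexpi t)) = Cexpi t).
  { intros t; rewrite Cconj_Cexpi; field; split;
      [apply Cexpi_neq0|exact (F_1_neq_0 Cx_field_theory)]. }
  assert (Hez : forall (k : nat) l t,
    ez (Z.of_nat k - l) t = Cmul (Cpow (Cexpi t) k) (ez (- l) t)).
  { intros k l t; unfold Z.sub; now rewrite ez_add, ez_nat. }
  rewrite Cscale_mul, RtoC_mul, (RtoC_inv _ HN), RtoC_Cnorm2.
  rewrite mono_ez.
  unfold analytic_part, coanalytic_part, Lformula, ptilde; cbv zeta.
  rewrite !Inv, Cconj_RtoC.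
  rewrite <- (RtoC_inv r) by lra.
  repeat rewrite ?Cconj_mul, ?Cconj_div, ?Cconj_sub, ?Cconj_ez, ?Cconj_invol,
    ?Cconj_pow, ?Cconj_RtoC.
  replace (- (i - Z.of_nat n))%Z with (Z.of_nat n - i)%Z by lia.
  rewrite !Hez, !Cconj_Cexpi.
  (* For symbolic [n], [(1/z)^n] has to be identified with [1/z^n] by hand; [|z^n| = 1] provides
     this. *)
  assert (Hi : Cmul (Cpow (Cexpi th) n) (Cpow (Cinv (Cexpi th)) n) = C1).
  { rewrite <- Cconj_Cexpi, <- Cconj_pow, <- RtoC_Cnorm2.
    replace (Cnorm2 (Cpow (Cexpi th) n)) with 1; [reflexivity|].
    rewrite <- ez_nat; unfold ez; now rewrite Cexpi_norm. }
  replace (Cpow (Cinv (Cexpi th)) n) with (Cinv (Cpow (Cexpi th) n)).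
  2: { replace (Cpow (Cinv (Cexpi th)) n) with (Cmul (Cinv (Cpow (Cexpi th) n))
         (Cmul (Cpow (Cexpi th) n) (Cpow (Cinv (Cexpi th)) n)))
         by (generalize dependent (Cpow (Cexpi th) n); intros; field; assumption).
       rewrite Hi; ring. }
  clear Hi Hez Inv HN.
  (* With polynomial values and powers abstracted, a rational identity in independent variables
     remains. *)
  generalize dependent (RtoC (/ (4 * PI * PI))); intros q.
  generalize dependent (Cconj (peval n m c (Cexpi th) (Cexpi ph))).
  generalize dependent (peval n m c (Cexpi th) (Cexpi ph)).
  generalize (Cconj (peval n m c (Cexpi th) (RtoC r))).
  generalize (peval n m c (Cexpi th) (RtoC (/ r))).
  generalize dependent (Cpow (Cexpi th) n).
  generalize (Cpow (RtoC r) m), (Cpow (Cexpi ph) m), (ez (- i) th), (ez (- j) ph).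
  generalize dependent (Cexpi ph); generalize dependent (RtoC r).
  intros; field; repeat split; auto.
Qed.

Lemma cont2_analytic_part (n m : nat) (c : nat -> nat -> Cx) (r : R) (i j : Z) :
  stable n m c -> 0 < r < 1 -> cont2 (analytic_part n m c r i j).
Proof.
  intros Hs Hr; unfold analytic_part; cbv zeta.
  apply cont2_mul; [apply cont2_mul; [apply cont2_mul|]|].
  - apply cont2_ez_fst.
  - apply cont2_ez_snd.
  - apply cont2_div; [| |intros; now apply stable_torus]; apply cont2_peval;
      auto using cont2_Cexpi_fst, cont2_Cexpi_snd, cont2_const.
  - apply cont2_div; [apply cont2_Cexpi_snd| |].
    + apply cont2_sub; [apply cont2_Cexpi_snd|apply cont2_const].
    + intros; now apply Cexpi_sub_neq0, Cnorm2_RtoC.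
Qed.

Lemma cont2_coanalytic_part (n m : nat) (c : nat -> nat -> Cx) (r : R) (i j : Z) :
  stable n m c -> 0 < r < 1 -> cont2 (coanalytic_part n m c r i j).
Proof.
  intros Hs Hr; unfold coanalytic_part; cbv zeta.
  apply cont2_div; [apply cont2_mul; apply cont2_mul|apply cont2_mul|].
  - apply cont2_ez_fst.
  - apply cont2_ez_snd.
  - apply cont2_const.
  - apply cont2_peval; [apply cont2_Cexpi_fst|apply cont2_const].
  - apply cont2_peval; [apply cont2_Cexpi_fst|apply cont2_Cexpi_snd].
  - apply cont2_sub; [apply cont2_const|].
    apply cont2_mul; [apply cont2_const|apply cont2_Cexpi_snd].
  - intros s t; apply Cmul_neq0; [now apply stable_torus|].
    apply one_sub_mul_neq0; [now apply Cnorm2_RtoC|rewrite Cexpi_norm; lra].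
Qed.

Lemma DInt_analytic_part_high (n m : nat) (c : nat -> nat -> Cx) (r : R) (i j : Z) :
  stable n m c -> 0 < r < 1 -> (Z.of_nat n < i)%Z ->
  DInt (fun th ph => Cconj (analytic_part n m c r i j th ph)) = C0.
Proof.
  intros Hs Hr Hi; apply DInt_first_zero; intros ph.
  rewrite CInt_conj by now apply cont2_cont1, cont2_analytic_part.
  (* The exponent [i - n] is written as the successor [S k], so that [f] visibly vanishes at
     [C0]. *)
  set (k := Z.to_nat (i - Z.of_nat n - 1)).
  set (f := fun z => Cmul (Cmul (Cmul (Cpow z (S k)) (peval n m c z (RtoC r)))
     (Cinv (peval n m c z (Cexpi ph))))
     (Cmul (ez j ph) (Cdiv (Cexpi ph) (Csub (Cexpi ph) (RtoC r))))).
  rewrite (CInt_ext _ (fun th => f (Cexpi th))).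
  - rewrite mean_value_circle.
    + unfold f; simpl; apply Cx_eq; simpl; ring.
    + apply disc_holo_mul; [|apply disc_holo_const].
      apply disc_holo_mul;
        [apply disc_holo_mul; [apply disc_holo_pow|apply disc_holo_peval_fst]|].
      apply disc_holo_inv; [apply disc_holo_peval_fst|].
      intros z Hz; apply Hs; [exact Hz|rewrite Cexpi_norm; lra].
  - intros th; unfold analytic_part, f; cbv zeta.
    replace (i - Z.of_nat n)%Z with (Z.of_nat (S k)) by (unfold k; lia).
    rewrite ez_nat; unfold Cdiv; ring.
Qed.

Lemma DInt_analytic_part_nonneg (n m : nat) (c : nat -> nat -> Cx) (r : R) (i j : Z) :
  stable n m c -> 0 < r < 1 -> (0 <= j)%Z ->
  DInt (fun th ph => Cconj (analytic_part n m c r i j th ph)) =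
  if Z.eq_dec i (Z.of_nat n)
  then Cmul (RtoC (4 * PI * PI)) (Cpow (RtoC r) (Z.to_nat j)) else C0.
Proof.
  intros Hs Hr Hj.
  set (k := Z.to_nat j).
  rewrite (DInt_second _ (fun th => Cmul (Cmul (RtoC (2 * PI)) (Cpow (RtoC r) k))
    (ez (Z.of_nat n - i) th))).
  - rewrite CInt_mul by apply cont1_ez.
    rewrite CInt_ez.
    destruct (Z.eq_dec i (Z.of_nat n)), (Z.eq_dec (Z.of_nat n - i) 0); try lia; [|ring].
    replace (4 * PI * PI) with (2 * PI * (2 * PI)) by ring.
    rewrite (RtoC_mul (2 * PI)); ring.
  - now apply cont2_conj, cont2_analytic_part.
  - intros th.
    set (f := fun w => Cmul (Cmul (Cpow w k) (Cinv (peval n m c (Cexpi th) w)))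
      (Cmul (peval n m c (Cexpi th) (RtoC r)) (ez (i - Z.of_nat n) th))).
    rewrite (CInt_ext _ (fun ph => Cconj (Cmul (f (Cexpi ph))
      (Cdiv (Cexpi ph) (Csub (Cexpi ph) (RtoC r)))))).
    2: { intros ph; unfold analytic_part, f; cbv zeta; f_equal.
         replace j with (Z.of_nat k) by (unfold k; lia).
         rewrite ez_nat; unfold Cdiv; ring. }
    assert (H0 : forall w, Cnorm2 w <= 1 -> peval n m c (Cexpi th) w <> C0).
    { intros w Hw; apply Hs; [rewrite Cexpi_norm; lra|exact Hw]. }
    assert (Hf : disc_holo f).
    { apply disc_holo_mul; [|apply disc_holo_const].
      apply disc_holo_mul; [apply disc_holo_pow|].
      apply disc_holo_inv; [apply disc_holo_peval_snd|exact H0]. }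
    rewrite CInt_conj.
    + rewrite cauchy_circle by (assumption || now apply Cnorm2_RtoC).
      rewrite Cconj_mul, Cconj_RtoC.
      (* At the pole [w = r] the two values of [p] cancel, so the moment does not depend on [c]. *)
      replace (f (RtoC r)) with (Cmul (Cpow (RtoC r) k) (ez (i - Z.of_nat n) th)).
      * rewrite Cconj_mul, Cconj_pow, Cconj_RtoC, Cconj_ez.
        replace (- (i - Z.of_nat n))%Z with (Z.of_nat n - i)%Z by lia; ring.
      * unfold f; field; apply H0; left; now apply Cnorm2_RtoC.
    + apply (cont2_cont1 (fun ph _ => Cmul (f (Cexpi ph))
        (Cdiv (Cexpi ph) (Csub (Cexpi ph) (RtoC r)))) 0); unfold f.
      assert (CE := cont2_Cexpi_fst).
      repeat apply cont2_mul; auto using cont2_const, cont2_pow.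
      * apply cont2_inv; [apply cont2_peval; auto using cont2_const|].
        intros; apply H0; rewrite Cexpi_norm; lra.
      * apply cont2_inv; [apply cont2_sub; auto using cont2_const|].
        intros; now apply Cexpi_sub_neq0, Cnorm2_RtoC.
Qed.

(** The point [1 / r] lies outside the disc, where stability says nothing about [p]; but [p(z, 1/r)]
    stands in the numerator, and the divisors are [1 - r w] and values of [p] on the closed
    bidisc. *)
Lemma DInt_coanalytic_part_low_fst (n m : nat) (c : nat -> nat -> Cx) (r : R) (i j : Z) :
  stable n m c -> 0 < r < 1 -> (i < Z.of_nat n)%Z ->
  DInt (coanalytic_part n m c r i j) = C0.
Proof.
  intros Hs Hr Hi; apply DInt_first_zero; intros ph.
  set (k := Z.to_nat (Z.of_nat n - i - 1)).
  set (f := fun z => Cmul (Cmul (Cmul (Cpow z (S k)) (peval n m c z (RtoC (/ r))))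
     (Cinv (peval n m c z (Cexpi ph))))
     (Cmul (Cmul (ez (Z.of_nat m - j) ph) (Cpow (RtoC r) m))
       (Cinv (Csub C1 (Cmul (RtoC r) (Cexpi ph)))))).
  assert (H0 : forall z, Cnorm2 z <= 1 -> peval n m c z (Cexpi ph) <> C0).
  { intros z Hz; apply Hs; [exact Hz|rewrite Cexpi_norm; lra]. }
  rewrite (CInt_ext _ (fun th => f (Cexpi th))).
  - rewrite mean_value_circle.
    + unfold f; simpl; ring.
    + apply disc_holo_mul; [|apply disc_holo_const].
      apply disc_holo_mul;
        [apply disc_holo_mul; [apply disc_holo_pow|apply disc_holo_peval_fst]|].
      apply disc_holo_inv; [apply disc_holo_peval_fst|exact H0].
  - intros th; unfold coanalytic_part, f; cbv zeta.
    replace (Z.of_nat n - i)%Z with (Z.of_nat (S k)) by (unfold k; lia).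
    rewrite ez_nat; field; split.
    + apply one_sub_mul_neq0; [now apply Cnorm2_RtoC|rewrite Cexpi_norm; lra].
    + now apply stable_torus.
Qed.

Lemma DInt_coanalytic_part_low_snd (n m : nat) (c : nat -> nat -> Cx) (r : R) (i j : Z) :
  stable n m c -> 0 < r < 1 -> (j < Z.of_nat m)%Z ->
  DInt (coanalytic_part n m c r i j) = C0.
Proof.
  intros Hs Hr Hj.
  rewrite (DInt_second _ (fun _ => C0)); [rewrite CInt_const; ring| |].
  { now apply cont2_coanalytic_part. }
  intros th.
  set (k := Z.to_nat (Z.of_nat m - j - 1)).
  set (f := fun w => Cmul (Cmul (Cmul (Cpow w (S k)) (Cinv (peval n m c (Cexpi th) w)))
     (Cinv (Csub C1 (Cmul (RtoC r) w))))
     (Cmul (ez (Z.of_nat n - i) th)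
        (Cmul (Cpow (RtoC r) m) (peval n m c (Cexpi th) (RtoC (/ r)))))).
  assert (H0 : forall w, Cnorm2 w <= 1 -> peval n m c (Cexpi th) w <> C0).
  { intros w Hw; apply Hs; [rewrite Cexpi_norm; lra|exact Hw]. }
  assert (H1 : forall w, Cnorm2 w <= 1 -> Csub C1 (Cmul (RtoC r) w) <> C0).
  { intros w; apply one_sub_mul_neq0; now apply Cnorm2_RtoC. }
  rewrite (CInt_ext _ (fun ph => f (Cexpi ph))).
  - rewrite mean_value_circle.
    + unfold f; simpl; ring.
    + apply disc_holo_mul; [|apply disc_holo_const].
      apply disc_holo_mul; [apply disc_holo_mul; [apply disc_holo_pow|]|].
      * apply disc_holo_inv; [apply disc_holo_peval_snd|exact H0].
      * apply disc_holo_inv; [apply disc_holo_one_sub_mul|exact H1].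
  - intros ph; unfold coanalytic_part, f; cbv zeta.
    replace (Z.of_nat m - j)%Z with (Z.of_nat (S k)) by (unfold k; lia).
    rewrite ez_nat; field; split; [apply H1|apply H0]; rewrite Cexpi_norm; lra.
Qed.

(** The condition on [(i, j)] lists when both terms are under control. In the first alternative the
    analytic term vanishes through [z] and the other through [w]; in the second, Cauchy's formula
    evaluates the analytic term and either variable kills the other. It covers [in_O], and [in_Ok]
    for [k < m]. *)
Lemma Lformula_moment (n m : nat) (c : nat -> nat -> Cx) (r : R) (i j : Z)
  (F : R -> R -> Cx) :
  stable n m c -> 0 < r < 1 ->
  ((Z.of_nat n < i /\ j < Z.of_nat m) \/
   (0 <= j /\ (i < Z.of_nat n \/ j < Z.of_nat m)))%Z ->
  (forall th ph, F th ph =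
    Cscale (/ (4 * PI * PI) * / Cnorm2 (peval n m c (Cexpi th) (Cexpi ph)))
    (Cmul (Lformula n m c (Cexpi th) (Cexpi ph) (RtoC r)) (Cconj (mono i j th ph)))) ->
  cont2 F /\
  DInt F = if Z.eq_dec i (Z.of_nat n) then Cpow (RtoC r) (Z.to_nat j) else C0.
Proof.
  intros Hs Hr Hij HF.
  set (q := RtoC (/ (4 * PI * PI))).
  assert (E : F = fun th ph =>
    Cadd (Cmul q (Cconj (analytic_part n m c r i j th ph)))
         (Cmul (Copp q) (coanalytic_part n m c r i j th ph))).
  { apply functional_extensionality; intros th; apply functional_extensionality; intros ph.
    rewrite HF, Lformula_torus by assumption; fold q; ring. }
  assert (CA := cont2_conj _ (cont2_analytic_part n m c r i j Hs Hr)).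
  assert (CB := cont2_coanalytic_part n m c r i j Hs Hr).
  assert (Hq : Cmul q (RtoC (4 * PI * PI)) = C1).
  { unfold q; rewrite <- RtoC_mul, Rinv_l; [reflexivity|].
    pose proof PI_RGT_0; nra. }
  rewrite E; split; [now apply cont2_lin|].
  rewrite DInt_lin by assumption.
  assert (VB : DInt (coanalytic_part n m c r i j) = C0).
  { destruct (Z_lt_le_dec i (Z.of_nat n)).
    - now apply DInt_coanalytic_part_low_fst.
    - apply DInt_coanalytic_part_low_snd; auto; lia. }
  rewrite VB.
  destruct (Z_lt_le_dec j 0) as [Hj|Hj].
  - rewrite DInt_analytic_part_high by (auto; lia).
    destruct (Z.eq_dec i (Z.of_nat n)); [lia|ring].
  - rewrite DInt_analytic_part_nonneg by assumption.
    destruct (Z.eq_dec i (Z.of_nat n)); [|ring].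
    set (p4 := RtoC (4 * PI * PI)) in *.
    transitivity (Cmul (Cmul q p4) (Cpow (RtoC r) (Z.to_nat j))); [ring|rewrite Hq; ring].
Qed.

(** * From polynomials in [r] to their coefficients *)

(** Replacing [r] by [r / 2] and multiplying by [2^N] scales the coefficient of [r^j] by [2^(N-j)];
    subtracting the original leaves [2^(N-j) - 1], which is zero exactly at the top index
    [j = N]. *)
Lemma Csum_dilation_difference (N : nat) (r : R) (a : nat -> Cx) :
  Cadd (Cmul (RtoC (2 ^ N)) (Csum (S N) (fun j => Cmul (a j) (Cpow (RtoC (r / 2)) j))))
       (Cmul (Copp C1) (Csum (S N) (fun j => Cmul (a j) (Cpow (RtoC r) j)))) =
  Csum N (fun j => Cmul (Cmul (RtoC (2 ^ N * (/ 2) ^ j - 1)) (a j)) (Cpow (RtoC r) j)).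
Proof.
  rewrite <- !Csum_Cmul.
  transitivity (Csum (S N) (fun j =>
    Cmul (Cmul (RtoC (2 ^ N * (/ 2) ^ j - 1)) (a j)) (Cpow (RtoC r) j))).
  - match goal with |- Cadd ?x (Csum _ ?f) = _ =>
      replace (Cadd x (Csum (S N) f)) with (Csub x (Csum (S N) (fun j => Copp (f j)))) end.
    + rewrite <- Csum_sub; apply Csum_ext; intros j _.
      rewrite !Cpow_RtoC; unfold Rdiv; rewrite Rpow_mult_distr.
      apply Cx_eq; simpl; ring.
    + match goal with |- Csub _ (Csum _ ?g) = Cadd _ (Csum _ ?f) =>
        replace (Csum (S N) f) with (Cmul (Copp C1) (Csum (S N) g)); [ring|] end.
      rewrite <- Csum_Cmul; apply Csum_ext; intros j _; ring.
  - simpl.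
    replace (2 ^ N * (/ 2) ^ N - 1) with 0; [apply Cx_eq; simpl; ring|].
    rewrite <- Rpow_mult_distr, Rinv_r, pow1 by lra; ring.
Qed.

(* Dilating [r] by 1/2 and subtracting kills the top coefficient, so that no Vandermonde
   system has to be inverted. *)
Lemma coefficient_extraction (P : (R -> R -> Cx) -> Cx -> Prop) :
  (forall x y F G u v, P F u -> P G v ->
    P (fun s t => Cadd (Cmul x (F s t)) (Cmul y (G s t))) (Cadd (Cmul x u) (Cmul y v))) ->
  forall (N : nat) (a : nat -> R -> R -> Cx) (v : nat -> Cx),
  (forall r, 0 < r < 1 ->
    P (fun s t => Csum N (fun j => Cmul (a j s t) (Cpow (RtoC r) j)))
      (Csum N (fun j => Cmul (v j) (Cpow (RtoC r) j)))) ->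
  forall j, (j < N)%nat -> P (a j) (v j).
Proof.
  intros lin; induction N as [|N IH]; intros a v H j Hj; [lia|].
  assert (scale : forall x F u, P F u -> P (fun s t => Cmul x (F s t)) (Cmul x u)).
  { intros x F u HF.
    replace (Cmul x u) with (Cadd (Cmul x u) (Cmul C0 u)) by ring.
    replace (fun s t => Cmul x (F s t)) with
      (fun s t => Cadd (Cmul x (F s t)) (Cmul C0 (F s t))); [now apply lin|].
    apply functional_extensionality; intros s; apply functional_extensionality; intros t.
    ring. }
  assert (lower : forall k, (k < N)%nat -> P (a k) (v k)).
  { intros k Hk.
    set (d := fun l => RtoC (2 ^ N * (/ 2) ^ l - 1)).
    assert (Hd : d k <> C0).
    { apply RtoC_neq0.
      replace N with (k + (N - k))%nat by lia.
      rewrite pow_add; replace (2 ^ k * 2 ^ (N - k) * (/ 2) ^ k) with (2 ^ (N - k)).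
      - assert (1 < 2 ^ (N - k)) by (apply Rlt_pow_R1; [lra|lia]); lra.
      - transitivity (2 ^ (N - k) * (2 * / 2) ^ k); [rewrite Rinv_r, pow1 by lra; ring|].
        rewrite Rpow_mult_distr; ring. }
    replace (v k) with (Cmul (Cinv (d k)) (Cmul (d k) (v k))) by (field; assumption).
    replace (a k) with (fun s t => Cmul (Cinv (d k)) (Cmul (d k) (a k s t))).
    - apply scale.
      apply (IH (fun l s t => Cmul (d l) (a l s t)) (fun l => Cmul (d l) (v l)));
        [|exact Hk].
      intros r Hr.
      assert (Hr2 : 0 < r / 2 < 1) by lra.
      pose proof (lin (RtoC (2 ^ N)) (Copp C1) _ _ _ _ (H _ Hr2) (H _ Hr)) as D.
      cbv beta in D; rewrite Csum_dilation_difference in D.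
      replace (fun s t => Csum N (fun l => Cmul (Cmul (d l) (a l s t)) (Cpow (RtoC r) l)))
        with (fun s t : R => Cadd
          (Cmul (RtoC (2 ^ N))
             (Csum (S N) (fun j => Cmul (a j s t) (Cpow (RtoC (r / 2)) j))))
          (Cmul (Copp C1) (Csum (S N) (fun j => Cmul (a j s t) (Cpow (RtoC r) j)))));
        [exact D|].
      apply functional_extensionality; intros s; apply functional_extensionality; intros t.
      apply (Csum_dilation_difference N r (fun l => a l s t)).
    - apply functional_extensionality; intros s; apply functional_extensionality; intros t.
      field; assumption. }
  destruct (Nat.eq_dec j N) as [->|]; [|apply lower; lia].
  (* The top coefficient is isolated at the single value [r = 1/2], by subtracting the lower terms
     and dividing by [(1/2)^N]. *)
  assert (Hh : 0 < / 2 < 1) by lra.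
  assert (part : forall k, (k <= N)%nat ->
    P (fun s t => Csum k (fun l => Cmul (a l s t) (Cpow (RtoC (/ 2)) l)))
      (Csum k (fun l => Cmul (v l) (Cpow (RtoC (/ 2)) l)))).
  { induction k as [|k IHk]; intros Hk.
    (* The zero function is only reached as a zero multiple of a function already known to satisfy
       [P]. *)
    - pose proof (scale C0 _ _ (H _ Hh)) as D; cbv beta in D.
      match type of D with P ?F ?u =>
        assert (EF : F = fun _ _ => C0); [|assert (Eu : u = C0) by ring] end.
      { apply functional_extensionality; intros s; apply functional_extensionality; intros t.
        ring. }
      rewrite EF, Eu in D; exact D.
    - simpl.
      pose proof (lin C1 (Cpow (RtoC (/ 2)) k) _ _ _ _ (IHk ltac:(lia))
        (lower k ltac:(lia))) as D.
      replace (Cadd _ _) with (Cadd (Cmul C1 (Csum k (fun l => Cmul (v l) (Cpow (RtoC (/ 2)) l))))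
        (Cmul (Cpow (RtoC (/ 2)) k) (v k))) by ring.
      match type of D with P ?F _ => match goal with |- P ?G _ => replace G with F end end;
        [exact D|].
      apply functional_extensionality; intros s; apply functional_extensionality; intros t.
      ring. }
  set (h := Cpow (RtoC (/ 2)) N).
  assert (Hh0 : h <> C0) by (apply Cpow_neq0, RtoC_neq0; lra).
  pose proof (lin (Cinv h) (Copp (Cinv h)) _ _ _ _ (H _ Hh) (part N (le_n N))) as D.
  simpl in D; fold h in D.
  match type of D with P ?F ?u =>
    replace F with (a N) in D; [replace u with (v N) in D; [exact D|field; assumption]|] end.
  apply functional_extensionality; intros s; apply functional_extensionality; intros t.
  field; assumption.
Qed.

(** * Moments of the [a_k] and orthogonality *)

Lemma ip_integrand_sum (n m : nat) (c : nat -> nat -> Cx) (N : nat)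
  (a : nat -> Cx -> Cx -> Cx) (x : nat -> Cx) (g : R -> R -> Cx) (th ph : R) :
  ip_integrand n m c (fun z w => Csum N (fun l => Cmul (a l z w) (x l))) g th ph =
  Csum N (fun l => Cmul (ip_integrand n m c (a l) g th ph) (x l)).
Proof.
  unfold ip_integrand; rewrite Cscale_mul; induction N as [|N IH]; simpl; [ring|].
  rewrite <- IH, Cscale_mul; ring.
Qed.

Lemma coefficient_moment (n m : nat) (c : nat -> nat -> Cx) (a : nat -> Cx -> Cx -> Cx)
  (i j : Z) (k : nat) :
  stable n m c -> L_coeffs n m c a ->
  ((Z.of_nat n < i /\ j < Z.of_nat m) \/
   (0 <= j /\ (i < Z.of_nat n \/ j < Z.of_nat m)))%Z ->
  (k < m)%nat ->
  cont2 (ip_integrand n m c (a k) (mono i j)) /\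
  DInt (ip_integrand n m c (a k) (mono i j)) =
    if Z.eq_dec i (Z.of_nat n) then if Nat.eq_dec k (Z.to_nat j) then C1 else C0 else C0.
Proof.
  intros Hs HL Hij.
  (* The extracted relation joins continuity to the value of the integral: additivity of [DInt]
     needs continuous integrands, and nothing else gives the continuity of [a k] on the torus. *)
  apply (coefficient_extraction (fun F u => cont2 F /\ DInt F = u)
    (fun x y F G u v HF HG => conj
       (cont2_lin x y F G (proj1 HF) (proj1 HG))
       (eq_trans (DInt_lin x y F G (proj1 HF) (proj1 HG))
          (f_equal2 (fun u v => Cadd (Cmul x u) (Cmul y v)) (proj2 HF) (proj2 HG))))
    m (fun k => ip_integrand n m c (a k) (mono i j))
    (fun k => if Z.eq_dec i (Z.of_nat n)
              then if Nat.eq_dec k (Z.to_nat j) then C1 else C0 else C0)).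
  intros r Hr.
  (* The moment [r^j] is read as a sum over [k < m] with a single nonzero coefficient; when [i = n]
     the hypothesis forces [0 <= j < m], so that this index is in range. *)
  replace (Csum m _) with
    (if Z.eq_dec i (Z.of_nat n) then Cpow (RtoC r) (Z.to_nat j) else C0).
  - apply (Lformula_moment n m c r i j); try assumption.
    intros th ph; rewrite <- ip_integrand_sum.
    unfold ip_integrand; do 2 f_equal.
    rewrite HL; [now rewrite Cconj_RtoC|apply Cexpi_neq0|apply Cexpi_neq0| |].
    + apply RtoC_neq0; lra.
    + rewrite Cconj_RtoC; intros E.
      apply (one_sub_mul_neq0 (RtoC r) (Cexpi ph)).
      * now apply Cnorm2_RtoC.
      * rewrite Cexpi_norm; lra.
      * replace (Cmul (RtoC r) (Cexpi ph)) with (Cmul (Cexpi ph) (RtoC r)) by ring.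
        rewrite E; ring.
  - rewrite (Csum_single m (Z.to_nat j)).
    + destruct (Z.eq_dec i (Z.of_nat n)).
      * rewrite (proj2 (Nat.ltb_lt _ _)) by lia.
        destruct (Nat.eq_dec (Z.to_nat j) (Z.to_nat j)); [ring|congruence].
      * destruct (Nat.ltb _ _); [ring|reflexivity].
    + intros l _ Hl; destruct (Z.eq_dec i (Z.of_nat n)); [|ring].
      destruct (Nat.eq_dec l (Z.to_nat j)); [congruence|ring].
Qed.

Theorem mainTheorem3 (n m : nat) (c : nat -> nat -> Cx) (a : nat -> Cx -> Cx -> Cx) :
  (1 <= n)%nat -> (1 <= m)%nat ->
  has_bidegree n m c -> stable n m c ->
  L_coeffs n m c a ->
  (forall (k : nat) (i j : Z), (k < m)%nat -> in_Ok n m k i j ->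
     orthogonal n m c (a k) (mono i j)) /\
  (forall (eta : Cx) (i j : Z), in_O n m i j ->
     orthogonal n m c (Lpoly m a eta) (mono i j)).
Proof.
  intros _ _ _ Hs HL; split.
  - intros k i j Hk Hij; unfold in_Ok in Hij.
    destruct (coefficient_moment n m c a i j k Hs HL) as [HC HD]; [lia|exact Hk|].
    apply orthogonal_of_DInt; [exact HC|rewrite HD].
    destruct (Z.eq_dec i (Z.of_nat n)); [|reflexivity].
    (* For [i = n], [in_Ok] leaves only [0 <= j < m] with [j <> k]; since [j >= 0], [Z.to_nat j] is
       faithful and differs from [k]. *)
    destruct (Nat.eq_dec k (Z.to_nat j)); [lia|reflexivity].
  - intros eta i j Hij; unfold in_O in Hij.
    assert (H : forall N, (N <= m)%nat ->
      cont2 (ip_integrand n m c (Lpoly N a eta) (mono i j)) /\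
      DInt (ip_integrand n m c (Lpoly N a eta) (mono i j)) = C0).
    { unfold Lpoly; induction N as [|N IH]; intros HN.
      - replace (ip_integrand _ _ _ _ _) with (fun _ _ : R => C0).
        + split; [apply cont2_const|apply DInt_first_zero; intros ph].
          rewrite CInt_const; ring.
        + apply functional_extensionality; intros th.
          apply functional_extensionality; intros ph.
          symmetry; apply ip_integrand_sum.
      - destruct IH as [C1' D1']; [lia|].
        destruct (coefficient_moment n m c a i j N Hs HL) as [C2' D2']; [lia|lia|].
        replace (ip_integrand n m c
          (fun z w => Csum (S N) (fun l => Cmul (a l z w) (Cpow (Cconj eta) l))) (mono i j))
          with (fun th ph => Cadd
            (Cmul C1 (ip_integrand n m c (fun z w => Csum N (fun l =>
               Cmul (a l z w) (Cpow (Cconj eta) l))) (mono i j) th ph))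
            (Cmul (Cpow (Cconj eta) N) (ip_integrand n m c (a N) (mono i j) th ph))).
        + split; [now apply cont2_lin|].
          rewrite DInt_lin, D1', D2' by assumption.
          destruct (Z.eq_dec i (Z.of_nat n)); [lia|ring].
        + apply functional_extensionality; intros th.
          apply functional_extensionality; intros ph.
          rewrite !(ip_integrand_sum n m c _ a (Cpow (Cconj eta))); simpl; ring. }
    destruct (H m (le_n m)); now apply orthogonal_of_DInt.
Qed.
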